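(* Let $(Y_k)_{k\in\mathbb{N}}$ be a strongly mixing, strongly stationary sequence of real random variables with rate function $(\alpha_h)_{h\in\mathbb{N}}$ such that $Y_1$ is regularly varying with index $\alpha\in(0,2)$, and let $(a_n)_{n\in\mathbb{N}}$ be a sequence in $(0,\infty)$ with $n\,\mathbb{P}(|Y_1|>a_n)\to1$ as $n\to\infty$. For a sequence $(m_n)_{n\in\mathbb{N}}$ in $\mathbb{N}$, say that property (M) holds with $(m_n)_{n\in\mathbb{N}}$ if $m_n\to\infty$ and $\lfloor n/m_n\rfloor\to\infty$ as $n\to\infty$, and for each $d\in\mathbb{N}$, $\vartheta_1,\ldots,\vartheta_d\in\mathbb{R}$ and $t_1,\ldots,t_d\in[0,\infty)$ with $0=:t_0<t_1<\cdots<t_d$, $$\Bigl|\varphi_{n,\lfloor nt_1\rfloor,\ldots,\lfloor nt_d\rfloor}(\vartheta_1,\ldots,\vartheta_d)-\prod_{\ell=1}^d\bigl(\varphi_{n,m_n}(\vartheta_\ell)\bigr)^{\lfloor(\lfloor nt_\ell\rfloor-\lfloor nt_{\ell-1}\rfloor)/m_n\rfloor}\Bigr|\to0\qquad\text{as }n\to\infty.$$ (i) If $(Y_k)_{k\in\mathbb{N}}$ is $M_0$-dependent with some $M_0\in\{0,1,2,\ldots\}$, or there exists a sequence $(\varepsilon_n)_{n\in\mathbb{N}}$ in $(0,\infty)$ such that $\varepsilon_n\to0$ as $n\to\infty$ and $$n\,\alpha_{\lfloor\varepsilon_na_n^{2\beta}/n\rfloor}\to0\qquad\text{as }n\to\infty$$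 with some $\beta\in\bigl(\tfrac{\alpha}{2},\alpha\wedge1\bigr)$, then property (M) holds with some sequence $(m_n)_{n\in\mathbb{N}}$ in $\mathbb{N}$, and there exists a sequence $(r_n)_{n\in\mathbb{N}}$ in $\mathbb{N}$ with $r_n\to\infty$ and $r_n/m_n\to0$ as $n\to\infty$ such that $$n\,\alpha_{r_n}\to0\qquad\text{as }n\to\infty.$$ (ii) If $(Y_k)_{k\in\mathbb{N}}$ is strongly mixing with geometric rate, then for arbitrary $\gamma_1,\gamma_2\in(0,1)$ satisfying $\gamma_1<\gamma_2$ and $\gamma_2\in\bigl(\tfrac12,\tfrac1\alpha\wedge1\bigr)$, setting $m_n=\lfloor n^{\gamma_2}\rfloor$ and $r_n=\lfloor n^{\gamma_1}\rfloor$, $n\in\mathbb{N}$, property (M) holds with $(m_n)_{n\in\mathbb{N}}$, and $r_n\to\infty$, $r_n/m_n\to0$ and $n\,\alpha_{r_n}\to0$ as $n\to\infty$.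
   Context: Notation: $\mathbb{N}$ is the set of positive integers; $x\wedge y=\min(x,y)$. $S_n:=Y_1+\cdots+Y_n$, $S_0:=0$. For $d\in\mathbb{N}$ and non-negative integers $j_1\leq\cdots\leq j_d$, with $j_0:=0$, $$\varphi_{n,j_1,\ldots,j_d}(\vartheta_1,\ldots,\vartheta_d):=\mathbb{E}\Bigl(\exp\Bigl\{\frac{i}{a_n}\sum_{\ell=1}^d\vartheta_\ell(S_{j_\ell}-S_{j_{\ell-1}})\Bigr\}\Bigr),\qquad\vartheta_1,\ldots,\vartheta_d\in\mathbb{R}.$$ A random variable $Y$ is regularly varying with index $\alpha\in(0,\infty)$ if $\mathbb{P}(|Y|>x)>0$ for all $x>0$, $\lim_{x\to\infty}\mathbb{P}(|Y|>cx)/\mathbb{P}(|Y|>x)=c^{-\alpha}$ for all $c>0$, and $\mathbb{P}(Y>x)/\mathbb{P}(|Y|>x)\to p$, $\mathbb{P}(Y\leq-x)/\mathbb{P}(|Y|>x)\to q$ as $x\to\infty$ for some $p,q\ge 0$ with $p+q=1$. Strongly stationary means that all finite dimensional distributions are invariant under time shifts. A strongly stationary sequence $(Y_k)_{k\in\mathbb{N}}$ is strongly mixing with rate function $(\alpha_h)_{h\in\mathbb{N}}$ if, for its strongly stationary two-sided extension $(\ldots,Y_{-1},Y_0,Y_1,\ldots)$, $$\alpha_h:=\sup_{A\in\mathcal{F}^Y_{-\infty,0},\ B\in\mathcal{F}^Y_{h,\infty}}|\mathbb{P}(A\cap B)-\mathbb{P}(A)\mathbb{P}(B)|\to0\qquad\text{as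 }h\to\infty,$$ where $\mathcal{F}^Y_{-\infty,0}:=\sigma(\ldots,Y_{-1},Y_0)$ and $\mathcal{F}^Y_{h,\infty}:=\sigma(Y_h,Y_{h+1},\ldots)$; $\alpha_0$ is defined by the same formula with $h=0$. It is strongly mixing with geometric rate if there is $q\in(0,1)$ with $\sup_{h\in\mathbb{N}}q^{-h}\alpha_h<\infty$. It is $M_0$-dependent if $\alpha_h=0$ for all $h>M_0$. *)

(* Defs.v *)
From mathcomp Require Export all_boot all_order all_algebra.
From mathcomp Require Export all_classical all_reals all_analysis.
From mathcomp Require Export complex.

Set Implicit Arguments.
Unset Strict Implicit.
Unset Printing Implicit Defensive.

Import Order.TTheory GRing.Theory Num.Theory numFieldNormedType.Exports.
Local Open Scope classical_set_scope.
Local Open Scope ring_scope.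

(* Sequences indexed by the positive integers are functions on [nat] whose
   value at 0 is never used. *)

Section process.
Context (R : realType) (d : measure_display) (T : measurableType d)
  (P : probability T R).

(* Joint law of (X_{t_1}, ..., X_{t_n}) on R^n. *)
Definition fdd (I : Type) (X : I -> {RV P >-> R}) (n : nat) (t : n.-tuple I) :
    set (n.-tuple (measurableTypeR R)) -> \bar R :=
  pushforward P (fun w => map_tuple (fun k => X k w : measurableTypeR R) t).

Definition strongly_stationary (Y : nat -> {RV P >-> R}) : Prop :=
  forall (n h : nat) (t : n.-tuple nat), all (leq 1) t ->
  forall A, measurable A -> fdd Y (map_tuple (addn h) t) A = fdd Y t A.

Definition strongly_stationaryZ (X : int -> {RV P >-> R}) : Prop :=
  forall (n : nat) (h : int) (t : n.-tuple int),
  forall A, measurable A -> fdd X (map_tuple (+%R h) t) A = fdd X t A.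

Definition sigma_algebra_of (X : int -> {RV P >-> R}) (K : set int) :
    set (set T) :=
  <<s \bigcup_(k in K) preimage_set_system setT (X k) measurable >>.

(* The supremum is taken over a nonempty set of reals bounded by 1. *)
Definition mixing_coef (X : int -> {RV P >-> R}) (h : nat) : R :=
  sup [set `|fine (P (A `&` B)) - fine (P A) * fine (P B)|
      | A in sigma_algebra_of X [set k | k <= 0]
      & B in sigma_algebra_of X [set k | h%:Z <= k]].

Definition regularly_varying (Y : {RV P >-> R}) (alpha : R) : Prop :=
  let tail (x : R) := fine (P [set w | x < `|Y w|]) in
  [/\ 0 < alpha,
      forall x : R, 0 < x -> 0 < tail x,
      forall c : R, 0 < c ->
        tail (c * x) / tail x @[x --> +oo] --> c `^ (- alpha)
    & exists p q : R, [/\ 0 <= p, 0 <= q, p + q = 1,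
        fine (P [set w | x < Y w]) / tail x @[x --> +oo] --> p
      & fine (P [set w | Y w <= - x]) / tail x @[x --> +oo] --> q]].

Definition partial_sum (Y : nat -> {RV P >-> R}) (n : nat) (w : T) : R :=
  \sum_(1 <= k < n.+1) Y k w.

Definition expi (x : R) : R[i] := Complex (cos x) (sin x).

Definition complex_expectation (Z : T -> R[i]) : R[i] :=
  Complex (fine 'E_P[fun w => complex.Re (Z w)])
          (fine 'E_P[fun w => complex.Im (Z w)]).

(* The ordinal [l : 'I_k] stands for the index l+1 of the usual notation:
   [tnth j l] is j_{l+1} and [nth 0 (0 :: j) l] is j_l, with j_0 = 0. *)
Definition phi (Y : nat -> {RV P >-> R}) (a : nat -> R) (n : nat) (k : nat)
    (j : k.-tuple nat) (theta : k.-tuple R) : R[i] :=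
  complex_expectation (fun w => expi ((a n)^-1 *
    \sum_(l < k) tnth theta l *
      (partial_sum Y (tnth j l) w - partial_sum Y (nth 0%N (0%N :: j) l) w))).

(* [path <%R 0 t] says 0 < t_1 < ... < t_k; [Num.truncn] is the integer part,
   applied here to nonnegative reals only. *)
Definition property_M (Y : nat -> {RV P >-> R}) (a : nat -> R)
    (m : nat -> nat) : Prop :=
  [/\ m n @[n --> \oo] --> \oo,
      (n %/ m n)%N @[n --> \oo] --> \oo
    & forall (k : nat) (theta t : k.-tuple R), (0 < k)%N -> path <%R 0 t ->
      let fl n (x : R) := Num.truncn (n%:R * x) in
      Normc.normc
        (phi Y a n (map_tuple (fl n) t) theta -
         \prod_(l < k) phi Y a n [tuple m n] [tuple tnth theta l] ^+
           ((fl n (tnth t l) - fl n (nth 0%R (0%R :: tval t) l)) %/ m n)%N)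
        @[n --> \oo] --> (0 : R)].

End process.

Definition two_sided_extension (R : realType)
    (d : measure_display) (T : measurableType d) (P : probability T R)
    (d' : measure_display) (T' : measurableType d') (P' : probability T' R)
    (Y : nat -> {RV P >-> R}) (X : int -> {RV P' >-> R}) : Prop :=
  strongly_stationaryZ X /\
  forall (n : nat) (t : n.-tuple nat), all (leq 1) t ->
  forall A, measurable A -> fdd X (map_tuple Posz t) A = fdd Y t A.

(* The two-sided extension may live on another probability space; it is unique
   in law, so [rate] does not depend on its choice. *)
Definition strongly_mixing (R : realType)
    (d : measure_display) (T : measurableType d) (P : probability T R)
    (Y : nat -> {RV P >-> R}) (rate : nat -> R) : Prop :=
  (exists (d' : measure_display) (T' : measurableType d')
      (P' : probability T' R) (X : int -> {RV P' >-> R}),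
    two_sided_extension Y X /\ forall h, rate h = mixing_coef X h) /\
  rate h @[h --> \oo] --> (0 : R).

Definition geometric_rate (R : realType) (rate : nat -> R) : Prop :=
  exists q : R, [/\ 0 < q, q < 1 &
    (ereal_sup [set (q ^- h * rate h)%:E | h in [set h | (0 < h)%N]]
       < +oo)%E].

Definition M0_dependent (R : realType) (rate : nat -> R) (M0 : nat) : Prop :=
  forall h, (M0 < h)%N -> rate h = 0.

(* Main.v *)
Require Import Defs.
From mathcomp Require Import measurable_realfun ring lra zify.

Import Order.TTheory GRing.Theory Num.Theory numFieldNormedType.Exports.
Local Open Scope classical_set_scope.
Local Open Scope ring_scope.

Set Implicit Arguments.
Unset Strict Implicit.
Unset Printing Implicit Defensive.

(** The proof is Bernstein's method of big blocks separated by small gaps.  Cut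
    each index range of length N_l = floor(n t_l) - floor(n t_(l-1)) into full
    blocks of length m_n and a remainder shorter than m_n.  Deleting the first
    r_n terms of a block makes it r_n steps away from everything before it, so
    that by the covariance inequality [charfun_cov] its characteristic function
    splits off as a factor up to 16 alpha_(r_n); by stationarity this factor is
    the one of the first block, up to the same deleted terms.  Deleting terms
    is cheap: with Y_k multiplied by theta / a_n, the characteristic function
    moves by at most 2 E(|theta Y_1 / a_n| /\ 2) per deleted term
    ([charfun_segment]).  Summing over the at most n t_d / m_n blocks
    ([joint_charfun_blocks]) gives an error of order
      (n r_n / m_n + m_n) E(|Y_1| / a_n /\ 1) + n alpha_(r_n) / m_n.

    For beta < alpha /\ 1, the moment E|Y_1|^beta is finite, whence
    E(|theta Y_1| /\ 2) <= C |theta|^beta ([trunc_moment_le]), and the truncated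
    mean above is O(a_n^(-beta)).  Everything thus reduces to choosing
    m_n and r_n with
      n r_n / (m_n a_n^beta) -> 0,  m_n / a_n^beta -> 0,  n alpha_(r_n) -> 0,
    which is [property_M_of_gaps].  The only other input from regular variation
    is that a_n^s / n -> 0 for 0 < s < alpha and n / a_n^s -> 0 for s > alpha
    ([norming_upper], [norming_lower]).

    In part (i) put y_n = eps_n a_n^(2 beta) / n and take r_n of order y_n and
    m_n of order sqrt(n y_n) = sqrt(eps_n) a_n^beta: both gap conditions then
    are of order sqrt(eps_n).  One may enlarge eps_n at will, since the mixing
    coefficients decrease, and does so to force y_n -> oo; under
    M_0-dependence any such eps_n will do.  In part (ii) the gaps used for (M)
    may be shorter than floor(n^gamma_1): a geometric rate beats every power, so
    gaps n^delta with 1 + delta <= 2 gamma_2 bring both conditions down to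
    n^gamma_2 / a_n^beta -> 0, which holds as soon as
    alpha gamma_2 < beta. *)

(** * Expectations of bounded functions and the covariance inequality *)

Section bounded_expectation.
Context (R : realType) (d : measure_display) (T : measurableType d)
  (P : probability T R).
Implicit Types f g U V : T -> R.

Definition bounded_mfun f :=
  measurable_fun setT f /\ exists M, forall w, `|f w| <= M.

Lemma bounded_mfun_integrable f :
  bounded_mfun f -> P.-integrable setT (EFin \o f).
Proof.
move=> [mf [M fM]]; apply: measurable_bounded_integrable => //.
  by rewrite (le_lt_trans (probability_le1 _ _))// ltry.
exists M; split; first exact: num_real.
by move=> x Mx y _ /=; rewrite (le_trans (fM y))// ltW.
Qed.

Lemma fine_expectation f : fine 'E_P[f] = \int[P]_w f w.
Proof. by rewrite unlock. Qed.

Lemma bounded_mfun_cst (c : R) : bounded_mfun (fun=> c).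
Proof. by split => //; exists `|c|. Qed.

Lemma bounded_mfunD f g :
  bounded_mfun f -> bounded_mfun g -> bounded_mfun (fun w => f w + g w).
Proof.
move=> [mf [M fM]] [mg [N gN]]; split; first exact: measurable_funD.
by exists (M + N) => w; rewrite (le_trans (ler_normD _ _))// lerD.
Qed.

Lemma bounded_mfunM f g :
  bounded_mfun f -> bounded_mfun g -> bounded_mfun (fun w => f w * g w).
Proof.
move=> [mf [M fM]] [mg [N gN]]; split; first exact: measurable_funM.
by exists (M * N) => w; rewrite normrM ler_pM.
Qed.

Lemma bounded_mfunB f g :
  bounded_mfun f -> bounded_mfun g -> bounded_mfun (fun w => f w - g w).
Proof.
move=> bf bg.
have -> : (fun w => f w - g w) = (fun w => f w + (-1) * g w).
  by apply/funext => w; rewrite mulN1r.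
by apply: bounded_mfunD => //; apply: bounded_mfunM => //; exact: bounded_mfun_cst.
Qed.

Lemma bounded_mfun_norm f : bounded_mfun f -> bounded_mfun (fun w => `|f w|).
Proof.
move=> [mf [M fM]]; split; first exact: measurableT_comp.
by exists M => w; rewrite normr_id.
Qed.

Lemma bounded_mfun_sum I (s : seq I) (f : I -> T -> R) :
  (forall i, bounded_mfun (f i)) -> bounded_mfun (fun w => \sum_(i <- s) f i w).
Proof.
move=> bf; elim: s => [|i s IH].
  by under eq_fun do rewrite big_nil; exact: bounded_mfun_cst.
by under eq_fun do rewrite big_cons; exact: bounded_mfunD.
Qed.

Lemma bounded_mfun_indic (A : set T) : measurable A -> bounded_mfun (\1_A).
Proof.
move=> mA; split; first exact: measurable_indic.
by exists 1 => w; rewrite indicE; case: (_ \in _); rewrite ?normr1 ?normr0.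
Qed.

Lemma Rint_indic (A : set T) : measurable A -> \int[P]_w (\1_A w) = fine (P A).
Proof. by move=> mA; rewrite -fine_expectation expectation_indic. Qed.

Lemma Rint_cst (c : R) : \int[P]_w c = c.
Proof. by rewrite -fine_expectation expectation_cst. Qed.

Lemma RintD f g : bounded_mfun f -> bounded_mfun g ->
  \int[P]_w (f w + g w) = \int[P]_w f w + \int[P]_w g w.
Proof. by move=> ? ?; rewrite RintegralD//; exact: bounded_mfun_integrable. Qed.

Lemma RintB f g : bounded_mfun f -> bounded_mfun g ->
  \int[P]_w (f w - g w) = \int[P]_w f w - \int[P]_w g w.
Proof. by move=> ? ?; rewrite RintegralB//; exact: bounded_mfun_integrable. Qed.

Lemma RintZ (c : R) f : bounded_mfun f ->
  \int[P]_w (c * f w) = c * \int[P]_w f w.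
Proof. by move=> ?; rewrite RintegralZl//; exact: bounded_mfun_integrable. Qed.

Lemma Rint_sum I (s : seq I) (f : I -> T -> R) :
  (forall i, bounded_mfun (f i)) ->
  \int[P]_w (\sum_(i <- s) f i w) = \sum_(i <- s) \int[P]_w f i w.
Proof.
move=> bf; elim: s => [|i s IH].
  by under eq_Rintegral do rewrite big_nil; rewrite big_nil Rint_cst.
under eq_Rintegral do rewrite big_cons.
by rewrite big_cons RintD// ?IH//; exact: bounded_mfun_sum.
Qed.

Lemma le_Rint f g : bounded_mfun f -> bounded_mfun g ->
  (forall w, f w <= g w) -> \int[P]_w f w <= \int[P]_w g w.
Proof.
by move=> ? ? fg; apply: le_Rintegral => //; exact: bounded_mfun_integrable.
Qed.

Lemma normr_Rint_le f g : bounded_mfun f -> bounded_mfun g ->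
  (forall w, `|f w| <= g w) -> `|\int[P]_w f w| <= \int[P]_w g w.
Proof.
move=> bf bg fg; apply: le_trans (le_normr_Rintegral _ _) _ => //.
  exact: bounded_mfun_integrable.
by apply: le_Rint => //; exact: bounded_mfun_norm.
Qed.

Lemma normr_Rint_le_cst f (c : R) : bounded_mfun f ->
  (forall w, `|f w| <= c) -> `|\int[P]_w f w| <= c.
Proof.
move=> bf fc; rewrite -[leRHS](Rint_cst c) normr_Rint_le//.
exact: bounded_mfun_cst.
Qed.

(** Applied to x = n U(w), this replaces the [0, 1]-valued variable U by an
    average of n indicators. *)
Lemma sum_indic_approx n (x : R) : 0 <= x <= n%:R ->
  x <= \sum_(j < n) (j%:R < x)%R%:R <= x + 1.
Proof.
elim: n => [|n IH] /andP[x0 xn]; first by rewrite big_ord0; lra.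
rewrite big_ord_recr /=; have [xn'|xn'] := leP x n%:R.
  by rewrite addr0; apply: IH; rewrite x0.
suff -> : \sum_(i < n) (i%:R < x)%R%:R = n%:R :> R.
  by move: xn; rewrite -natr1 => xn; rewrite /=; lra.
rewrite (eq_bigr (fun=> 1)) => [|i _]; first by rewrite sumr_const card_ord.
by rewrite (lt_trans _ xn') ?ltr_nat.
Qed.

(** Both variables are within 1/n of averages of n indicators of their own
    level sets, and the covariance of two such averages is an average of
    covariances of events; then let n grow. *)
Lemma Rint_cov_le (F G : set (set T)) (al : R) U V :
    bounded_mfun U -> bounded_mfun V ->
    (forall w, 0 <= U w <= 1) -> (forall w, 0 <= V w <= 1) ->
    (forall s, F [set w | s < U w]) -> (forall s, G [set w | s < V w]) ->
    (forall A B, F A -> G B ->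
       `|fine (P (A `&` B)) - fine (P A) * fine (P B)| <= al) ->
  `|\int[P]_w (U w * V w) - \int[P]_w U w * \int[P]_w V w| <= al.
Proof.
move=> bU bV U01 V01 FU GV FG.
suff H n : (0 < n)%N ->
    `|\int[P]_w (U w * V w) - \int[P]_w U w * \int[P]_w V w| <= al + 6 / n%:R.
  apply/ler_addgt0Pr => e e0.
  have [n ne] : exists n, 6 / e < n.+1%:R.
    by exists (Num.truncn (6 / e)); exact: truncnS_gt.
  apply: le_trans (H n.+1 isT) _; rewrite lerD2l.
  by rewrite ler_pdivrMr// mulrC -ler_pdivrMr// ltW.
move=> n0; have n0' : 0 < n%:R :> R by rewrite ltr0n.
pose lev (W : T -> R) (j : 'I_n) : set T := [set w | j%:R / n%:R < W w].
pose D (W : T -> R) : T -> R := fun w => \sum_(j < n) n%:R^-1 * \1_(lev W j) w.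
have mlev W j : bounded_mfun W -> measurable (lev W j).
  move=> [mW _]; rewrite -[X in measurable X]setTI.
  rewrite (_ : lev W j = W @^-1` `](j%:R / n%:R), +oo[).
    exact: (mW measurableT).
  by apply/seteqP; split => w /=; rewrite in_itv /= andbT.
have bi W j : bounded_mfun W -> bounded_mfun (fun w => n%:R^-1 * \1_(lev W j) w).
  move=> bW; apply: bounded_mfunM; first exact: bounded_mfun_cst.
  by apply: bounded_mfun_indic; exact: mlev.
have bD W : bounded_mfun W -> bounded_mfun (D W).
  by move=> bW; apply: bounded_mfun_sum => j; exact: bi.
have DW (W : T -> R) w : (forall w, 0 <= W w <= 1) ->
    W w <= D W w <= W w + n%:R^-1.
  move=> W01; have /andP[w0 w1] := W01 w.
  have := @sum_indic_approx n (n%:R * W w).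
  rewrite mulr_ge0//= ger_pMr// => /(_ w1).
  have -> : \sum_(j < n) (j%:R < n%:R * W w)%R%:R = n%:R * D W w.
    rewrite /D mulr_sumr; apply: eq_bigr => j _; rewrite mulrA divff ?gt_eqF// mul1r.
    rewrite indicE; congr (_%:R : R); congr nat_of_bool.
    apply/idP/idP => [h|].
      by rewrite inE /lev /= ltr_pdivrMr// mulrC.
    by rewrite inE /lev /= ltr_pdivrMr// mulrC.
  move=> /andP[h1 h2]; rewrite -(ler_pM2l n0') h1 /= -(ler_pM2l n0') mulrDr.
  by rewrite divff ?gt_eqF.
have in01 : 0 < (n%:R^-1 : R) <= 1.
  by rewrite invr_gt0 n0' /= invf_le1// ler1n.
have D2 (W : T -> R) w : (forall w, 0 <= W w <= 1) -> 0 <= D W w <= 2.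
  by move=> W01; have := DW W w W01; have := W01 w; lra.
have cD : `|\int[P]_w (D U w * D V w) - \int[P]_w D U w * \int[P]_w D V w| <= al.
  have E1 : \int[P]_w (D U w * D V w) =
     \sum_(i < n) \sum_(j < n) n%:R^-1 ^+ 2 * fine (P (lev U i `&` lev V j)).
    transitivity (\int[P]_w \sum_(i < n) \sum_(j < n)
        (n%:R^-1 ^+ 2 * \1_(lev U i `&` lev V j) w)).
      apply: eq_Rintegral => w _; rewrite /D mulr_suml; apply: eq_bigr => i _.
      rewrite mulr_sumr; apply: eq_bigr => j _.
      by rewrite indicI /=; ring.
    have bij i j : bounded_mfun (\1_(lev U i `&` lev V j) : T -> R).
      by apply: bounded_mfun_indic; apply: measurableI; exact: mlev.
    rewrite Rint_sum => [|i]; last first.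
      apply: bounded_mfun_sum => j; apply: bounded_mfunM => //.
      exact: bounded_mfun_cst.
    apply: eq_bigr => i _; rewrite Rint_sum => [|j]; last first.
      by apply: bounded_mfunM => //; exact: bounded_mfun_cst.
    apply: eq_bigr => j _; rewrite RintZ// Rint_indic//.
    by apply: measurableI; exact: mlev.
  have E2 W : bounded_mfun W ->
      \int[P]_w D W w = \sum_(i < n) n%:R^-1 * fine (P (lev W i)).
    move=> bW; rewrite /D Rint_sum => [|i]; last exact: bi.
    apply: eq_bigr => i _; rewrite RintZ ?Rint_indic//; first exact: mlev.
    by apply: bounded_mfun_indic; exact: mlev.
  rewrite E1 !E2// mulr_suml -sumrB.
  apply: (@le_trans _ _ (\sum_(i < n) \sum_(j < n) n%:R^-1 ^+ 2 * al)); last first.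
    under eq_bigr do rewrite sumr_const card_ord.
    rewrite sumr_const card_ord -mulrnA -(mulr_natl _ (n * n)%N) natrM.
    rewrite [leLHS](_ : _ = al); first by [].
    by field; rewrite gt_eqF.
  apply: le_trans (ler_norm_sum _ _ _) _; apply: ler_sum => i _.
  rewrite mulr_sumr -sumrB.
  apply: le_trans (ler_norm_sum _ _ _) _; apply: ler_sum => j _.
  rewrite [X in `|X|](_ : _ = n%:R^-1 ^+ 2 *
     (fine (P (lev U i `&` lev V j)) - fine (P (lev U i)) * fine (P (lev V j))));
    last by ring.
  rewrite normrM ger0_norm; last by rewrite exprn_ge0// invr_ge0 ltW.
  by rewrite ler_wpM2l ?exprn_ge0 ?invr_ge0 ?(ltW n0')//; apply: FG; [exact: FU|exact: GV].
have dW W : bounded_mfun W -> (forall w, 0 <= W w <= 1) ->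
    `|\int[P]_w W w - \int[P]_w D W w| <= n%:R^-1.
  move=> bW W01; rewrite -(RintB bW (bD _ bW)); apply: normr_Rint_le_cst => [|w].
    by apply: bounded_mfunB => //; exact: bD.
  by have := DW W w W01; rewrite ler_norml; lra.
have dUV : `|\int[P]_w (U w * V w) - \int[P]_w (D U w * D V w)| <= 3 / n%:R.
  rewrite -RintB; [|exact: bounded_mfunM|by apply: bounded_mfunM; exact: bD].
  apply: normr_Rint_le_cst => [|w].
    by apply: bounded_mfunB; apply: bounded_mfunM => //; exact: bD.
  have := DW U w U01; have := DW V w V01; have := U01 w; have := V01 w.
  by move: (D U w) (D V w) (U w) (V w) => a b x y ????; rewrite ler_norml; nra.
have EW W : bounded_mfun W -> (forall w, 0 <= W w <= 1) ->
    0 <= \int[P]_w W w <= 1.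
  move=> bW W01; apply/andP; split.
    by apply: Rintegral_ge0 => w _; case/andP: (W01 w).
  rewrite -[leRHS]Rint_cst; apply: le_Rint => //; first exact: bounded_mfun_cst.
  by move=> w; case/andP: (W01 w).
have := dW U bU U01; have := dW V bV V01; have := EW U bU U01; have := EW V bV V01.
have ED : 0 <= \int[P]_w D V w by apply: Rintegral_ge0 => w _; case/andP: (D2 V w V01).
move: cD dUV ED; rewrite !ler_norml.
move: (\int[P]_w D V w) (\int[P]_w D U w) (\int[P]_w U w) (\int[P]_w V w).
move: n%:R^-1 in01 => i i01 dv du u v c1 c2 dv0 v01 u01 c3 c4.
have h1 : `|u * (v - dv)| <= i.
  rewrite normrM -[leRHS]mul1r ler_pM//; last by rewrite ler_norml; lra.
  by rewrite ger0_norm; lra.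
have h2 : `|(u - du) * dv| <= i * 2.
  rewrite normrM ler_pM//; first by rewrite ler_norml; lra.
  by rewrite ger0_norm; lra.
move: h1 h2; rewrite !ler_norml mulrBr mulrBl; lra.
Qed.

End bounded_expectation.

(** * Characteristic functions *)

Section charfun.
Context (R : realType) (d : measure_display) (T : measurableType d)
  (P : probability T R).
Implicit Types U V W : T -> R.

Definition charfun U : R[i] := complex_expectation P (fun w => expi (U w)).

Lemma charfunE U : charfun U = Complex (\int[P]_w cos (U w)) (\int[P]_w sin (U w)).
Proof. by rewrite /charfun /complex_expectation !fine_expectation. Qed.

Lemma measurable_cos : measurable_fun setT (cos : R -> R).
Proof. by apply: continuous_measurable_fun; exact: continuous_cos. Qed.

Lemma measurable_sin : measurable_fun setT (sin : R -> R).
Proof. by apply: continuous_measurable_fun; exact: continuous_sin. Qed.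

Lemma bounded_mfun_cos U : measurable_fun setT U -> bounded_mfun (fun w => cos (U w)).
Proof.
move=> mU; split; last by exists 1 => w; exact: cos_max.
exact: (measurableT_comp measurable_cos).
Qed.

Lemma bounded_mfun_sin U : measurable_fun setT U -> bounded_mfun (fun w => sin (U w)).
Proof.
move=> mU; split; last by exists 1 => w; exact: sin_max.
exact: (measurableT_comp measurable_sin).
Qed.

Lemma normc_le_abs (x y : R) : Normc.normc (Complex x y) <= `|x| + `|y|.
Proof.
rewrite /= -[leRHS]ger0_norm ?addr_ge0// -sqrtr_sqr ler_wsqrtr//.
rewrite sqrrD !real_normK ?num_real// lerD2r lerDl.
by rewrite mulrn_wge0// mulr_ge0.
Qed.

Lemma normc_charfun_le1 U : measurable_fun setT U -> Normc.normc (charfun U) <= 1.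
Proof.
move=> mU; rewrite charfunE /=.
set c := Rintegral _ _ _; set s := Rintegral _ _ _.
rewrite -sqrtr1 ler_wsqrtr//.
have bc := bounded_mfun_cos mU; have bs := bounded_mfun_sin mU.
(* The variance of the unit vector (cos U, sin U) is nonnegative. *)
have : 0 <= \int[P]_w (1 + c ^+ 2 + s ^+ 2 - (2 * c * cos (U w) + 2 * s * sin (U w))).
  apply: Rintegral_ge0 => w _.
  rewrite [leRHS](_ : _ = (cos (U w) - c) ^+ 2 + (sin (U w) - s) ^+ 2).
    by rewrite addr_ge0 ?sqr_ge0.
  by have := cos2Dsin2 (U w); lra.
have b1 (k : R) (f : T -> R) : bounded_mfun f -> bounded_mfun (fun w : T => k * f w).
  by move=> bf; apply: bounded_mfunM => //; exact: bounded_mfun_cst.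
have b1c := b1 (2 * c) _ bc; have b1s := b1 (2 * s) _ bs.
rewrite RintB; [|exact: bounded_mfun_cst|exact: bounded_mfunD b1c b1s].
rewrite (RintD P b1c b1s).
by rewrite Rint_cst !RintZ// -/c -/s; lra.
Qed.

Lemma cos_lipschitz (x y : R) : `|cos x - cos y| <= `|x - y|.
Proof.
wlog xy : x y / y <= x.
  move=> H; have [/H//|/ltW/H] := leP y x.
  by rewrite distrC [leRHS]distrC.
have [c _ ->] := @MVT_segment R cos (fun x => - sin x) y x xy
  (fun z _ => is_derive_cos z) (continuous_subspaceT (@continuous_cos R)).
by rewrite normrM normrN -[leRHS]mul1r ler_pM// sin_max.
Qed.

Lemma sin_lipschitz (x y : R) : `|sin x - sin y| <= `|x - y|.
Proof.
wlog xy : x y / y <= x.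
  move=> H; have [/H//|/ltW/H] := leP y x.
  by rewrite distrC [leRHS]distrC.
have [c _ ->] := @MVT_segment R sin cos y x xy
  (fun z _ => is_derive_sin z) (continuous_subspaceT (@continuous_sin R)).
by rewrite normrM -[leRHS]mul1r ler_pM// cos_max.
Qed.

Lemma bounded_mfun_min V : measurable_fun setT V ->
  bounded_mfun (fun w => Num.min `|V w| 2).
Proof.
move=> mV; split.
  by apply: measurable_minr => //; exact: measurableT_comp.
exists 2 => w; rewrite ger0_norm ?ge_min ?lexx ?orbT//.
Qed.

Lemma charfun_perturb U V : measurable_fun setT U -> measurable_fun setT V ->
  Normc.normc (charfun (fun w => U w + V w) - charfun U) <=
    2 * \int[P]_w Num.min `|V w| 2.
Proof.
move=> mU mV; have mUV : measurable_fun setT (fun w => U w + V w).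
  exact: measurable_funD.
rewrite !charfunE.
apply: le_trans (normc_le_abs _ _) _; rewrite mulr_natl mulr2n /=.
rewrite -RintB; [|exact: bounded_mfun_cos|exact: bounded_mfun_cos].
rewrite -RintB; [|exact: bounded_mfun_sin|exact: bounded_mfun_sin].
have D (f : R -> R) u v : (forall x, `|f x| <= 1) ->
    (forall x y, `|f x - f y| <= `|x - y|) ->
    `|f (u + v) - f u| <= Num.min `|v| 2.
  move=> f1 fL; rewrite le_min; apply/andP; split.
    by apply: le_trans (fL _ _) _; rewrite addrC addKr.
  apply: le_trans (ler_normB _ _) _.
  by have := f1 (u + v); have := f1 u; lra.
apply: lerD; apply: normr_Rint_le; try exact: bounded_mfun_min.
- by apply: bounded_mfunB; exact: bounded_mfun_cos.
- by move=> w; apply: D; [exact: cos_max|exact: cos_lipschitz].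
- by apply: bounded_mfunB; exact: bounded_mfun_sin.
- by move=> w; apply: D; [exact: sin_max|exact: sin_lipschitz].
Qed.

(** The addition formulas reduce this to four covariances of functions bounded
    by 1 in absolute value.  Each is 4 times the covariance of the rescaled
    [0, 1]-valued functions, so the real and imaginary parts cost 8 al each. *)
Lemma charfun_cov (F G : set (set T)) (al : R) U V :
    measurable_fun setT U -> measurable_fun setT V ->
    (forall B : set R, measurable B -> F (U @^-1` B)) ->
    (forall B : set R, measurable B -> G (V @^-1` B)) ->
    (forall A B, F A -> G B ->
       `|fine (P (A `&` B)) - fine (P A) * fine (P B)| <= al) ->
  Normc.normc (charfun (fun w => U w + V w) - charfun U * charfun V) <= 16 * al.
Proof.
move=> mU mV FU GV FG.
have cov (f g : R -> R) : measurable_fun setT f -> measurable_fun setT g ->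
    (forall x, `|f x| <= 1) -> (forall x, `|g x| <= 1) ->
    `|\int[P]_w (f (U w) * g (V w)) - \int[P]_w f (U w) * \int[P]_w g (V w)|
      <= 4 * al.
  move=> mf mg f1 g1.
  have bf : bounded_mfun (fun w => f (U w)).
    by split; [exact: (measurableT_comp mf)|exists 1].
  have bg : bounded_mfun (fun w => g (V w)).
    by split; [exact: (measurableT_comp mg)|exists 1].
  pose h (k : R -> R) x := 2^-1 * (1 + k x).
  have bh (k : R -> R) W : bounded_mfun (fun w => k (W w)) ->
      bounded_mfun (fun w => h k (W w)).
    move=> bk; apply: bounded_mfunM; first exact: bounded_mfun_cst.
    by apply: bounded_mfunD => //; exact: bounded_mfun_cst.
  have h01 (k : R -> R) x : (forall x, `|k x| <= 1) -> 0 <= h k x <= 1.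
    by move=> /(_ x); rewrite ler_norml /h; lra.
  have mh (k : R -> R) s : measurable_fun setT k -> measurable [set x | s < h k x].
    move=> mk; have mhk : measurable_fun setT (h k).
      by apply: measurable_funM => //; apply: measurable_funD.
    rewrite -[X in measurable X]setTI (_ : [set x | _] = h k @^-1` `]s, +oo[).
      exact: mhk.
    by apply/seteqP; split => w /=; rewrite in_itv /= andbT.
  have Ih (k : R -> R) W : bounded_mfun (fun w => k (W w)) ->
      \int[P]_w h k (W w) = 2^-1 * (1 + \int[P]_w k (W w)).
    move=> bk; rewrite RintZ; last by apply: bounded_mfunD => //; exact: bounded_mfun_cst.
    by rewrite RintD ?Rint_cst//; exact: bounded_mfun_cst.
  have := @Rint_cov_le _ _ _ P F G al (fun w => h f (U w)) (fun w => h g (V w))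
    (bh _ _ bf) (bh _ _ bg) (fun w => h01 _ _ f1) (fun w => h01 _ _ g1)
    (fun s => FU _ (mh _ s mf)) (fun s => GV _ (mh _ s mg)) FG.
  rewrite !Ih// (_ : \int[P]_w (h f (U w) * h g (V w)) =
    4^-1 * (1 + \int[P]_w f (U w) + \int[P]_w g (V w) +
       \int[P]_w (f (U w) * g (V w)))); last first.
    transitivity (\int[P]_w (4^-1 * (1 + f (U w) + g (V w) + f (U w) * g (V w)))).
      by apply: eq_Rintegral => w _; rewrite /h; field.
    have b1 : bounded_mfun (fun w => f (U w) * g (V w)) by exact: bounded_mfunM.
    have b2 : bounded_mfun (fun w => 1 + f (U w)).
      by apply: bounded_mfunD => //; exact: bounded_mfun_cst.
    have b3 : bounded_mfun (fun w => 1 + f (U w) + g (V w)) by exact: bounded_mfunD.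
    rewrite RintZ; last exact: bounded_mfunD.
    by rewrite !RintD ?Rint_cst//; exact: bounded_mfun_cst.
  move: (\int[P]_w (f (U w) * g (V w))) (\int[P]_w (f (U w))) (\int[P]_w (g (V w))).
  by move=> x y z; rewrite !ler_norml; lra.
have Hcc := cov _ _ measurable_cos measurable_cos (@cos_max R) (@cos_max R).
have Hss := cov _ _ measurable_sin measurable_sin (@sin_max R) (@sin_max R).
have Hcs := cov _ _ measurable_cos measurable_sin (@cos_max R) (@sin_max R).
have Hsc := cov _ _ measurable_sin measurable_cos (@sin_max R) (@cos_max R).
have bcU := bounded_mfun_cos mU; have bsU := bounded_mfun_sin mU.
have bcV := bounded_mfun_cos mV; have bsV := bounded_mfun_sin mV.
rewrite !charfunE.
under eq_Rintegral do rewrite cosD.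
under [X in Complex _ X - _]eq_Rintegral do rewrite sinD.
rewrite RintB; [|exact: bounded_mfunM|exact: bounded_mfunM].
rewrite RintD; [|exact: bounded_mfunM|exact: bounded_mfunM].
apply: le_trans (normc_le_abs _ _) _ => /=.
move: Hcc Hss Hcs Hsc.
move: (\int[P]_w (cos (U w) * cos (V w))) (\int[P]_w (sin (U w) * sin (V w))).
move: (\int[P]_w (cos (U w) * sin (V w))) (\int[P]_w (sin (U w) * cos (V w))).
move: (\int[P]_w cos (U w)) (\int[P]_w sin (U w)).
move: (\int[P]_w cos (V w)) (\int[P]_w sin (V w)).
move=> cv sv cu su cs sc cc ss Hcc Hss Hcs Hsc.
rewrite (_ : 16 * al = 8 * al + 8 * al); last by ring.
apply: lerD.
  rewrite [X in `|X|](_ : _ = (cc - cu * cv) - (ss - su * sv)); last by ring.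
  by apply: le_trans (ler_normB _ _) _; lra.
rewrite [X in `|X|](_ : _ = (sc - su * cv) + (cs - cu * sv)); last by ring.
by apply: le_trans (ler_normD _ _) _; lra.
Qed.

End charfun.

Section transfer.
Context (R : realType) (d1 d2 : measure_display) (T1 : measurableType d1)
  (T2 : measurableType d2) (P1 : probability T1 R) (P2 : probability T2 R).

(** Change of variables through the common law of [f1] and [f2]. *)
Lemma same_law_Rint (dE : measure_display) (E : measurableType dE)
    (f1 : T1 -> E) (f2 : T2 -> E) (g : E -> R) (M : R) :
    measurable_fun setT f1 -> measurable_fun setT f2 ->
    (forall A, measurable A -> P1 (f1 @^-1` A) = P2 (f2 @^-1` A)) ->
    measurable_fun setT g -> (forall x, `|g x| <= M) ->
  \int[P1]_w g (f1 w) = \int[P2]_w g (f2 w).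
Proof.
move=> m1 m2 e12 mg gM; rewrite /Rintegral; congr fine.
have i1 : P1.-integrable setT (EFin \o (fun w => g (f1 w))).
  apply: bounded_mfun_integrable; split; last by exists M.
  exact: (measurableT_comp mg).
have i2 : P2.-integrable setT (EFin \o (fun w => g (f2 w))).
  apply: bounded_mfun_integrable; split; last by exists M.
  exact: (measurableT_comp mg).
have mg' : measurable_fun setT (EFin \o g) by exact/measurable_EFinP.
have := integral_pushforward m1 (D := setT) mg' i1 measurableT.
rewrite preimage_setT => <-.
have := integral_pushforward m2 (D := setT) mg' i2 measurableT.
rewrite preimage_setT => <-.
by apply: eq_measure_integral => A mA _; exact: e12.
Qed.

End transfer.

(** * Mixing coefficients *)

Section mixing.
Context (R : realType) (d : measure_display) (T : measurableType d)
  (P : probability T R) (X : int -> {RV P >-> R}).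

(** Needed for the supremum that defines the coefficient to be an upper bound. *)
Lemma has_ubound_mixing h : has_ubound
  [set `|fine (P (A `&` B)) - fine (P A) * fine (P B)|
      | A in sigma_algebra_of X [set k | k <= 0]
      & B in sigma_algebra_of X [set k | h%:Z <= k]].
Proof.
have mS K A : sigma_algebra_of X K A -> measurable A.
  move=> /(_ measurable); apply; split.
    exact: sigma_algebra_measurable.
  move=> B [k _] [C mC <-]; exact: (@measurable_funP _ _ _ _ setT (X k)).
have p01 A : measurable A -> 0 <= fine (P A) <= 1.
  move=> mA; rewrite fine_ge0//= -[leRHS]/(fine 1%:E) fine_le//.
    by rewrite fin_num_measure.
  exact: probability_le1.
exists 1 => _ [A /mS mA [B /mS mB <-]].
have := p01 _ mA; have := p01 _ mB; have := p01 _ (measurableI _ _ mA mB).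
by rewrite ler_norml; nra.
Qed.

Lemma mixing_coef_ub h A B :
  sigma_algebra_of X [set k | k <= 0] A ->
  sigma_algebra_of X [set k | h%:Z <= k] B ->
  `|fine (P (A `&` B)) - fine (P A) * fine (P B)| <= mixing_coef X h.
Proof.
move=> FA GB; apply: (ub_le_sup (has_ubound_mixing h)).
by exists A => //; exists B.
Qed.

Lemma mixing_coef_le h k : (h <= k)%N -> mixing_coef X k <= mixing_coef X h.
Proof.
move=> hk; apply: sup_le_ub.
  exists `|fine (P (set0 `&` set0)) - fine (P set0) * fine (P set0)|.
  by exists set0; [exact: sigma_algebra0|exists set0 => //; exact: sigma_algebra0].
move=> _ [A FA [B GB <-]]; apply: mixing_coef_ub => //.
move: GB; apply: sub_sigma_algebra2 => C [j kj XC]; exists j => //=.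
by apply: le_trans kj; rewrite lez_nat.
Qed.

Lemma mixing_coef_ge0 h : 0 <= mixing_coef X h.
Proof.
apply: le_trans (mixing_coef_ub (A := set0) (B := set0) _ _) => //;
  exact: sigma_algebra0.
Qed.

Lemma sigma_algebra_of_sum (K : set int) (I : eqType) (s : seq I) (f : I -> int)
    (c : I -> R) (B : set R) :
  (forall i, i \in s -> K (f i)) -> measurable B ->
  sigma_algebra_of X K ((fun w => \sum_(i <- s) c i * X (f i) w) @^-1` B).
Proof.
move=> sK mB.
pose G : set (set T) :=
  \bigcup_(k in K) preimage_set_system setT (X k) measurable.
have mX k : K k -> measurable_fun setT (X k : g_sigma_algebraType G -> R).
  by move=> Kk _ C mC; apply: sub_sigma_algebra; exists k => //; exists C.
have mS : measurable_fun setT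
    ((fun w => \sum_(i <- s) c i * X (f i) w) : g_sigma_algebraType G -> R).
  elim: s sK => [|i s IH] sK.
    by under eq_fun do rewrite big_nil; exact: measurable_cst.
  under eq_fun do rewrite big_cons; apply: measurable_funD.
    apply: measurable_funM; first exact: measurable_cst.
    by apply: mX; apply: sK; rewrite mem_head.
  by apply: IH => j js; apply: sK; rewrite inE js orbT.
by have := mS measurableT B mB; rewrite setTI.
Qed.

End mixing.

Section tuples.
Context (R : realType) (d : measure_display) (T : measurableType d)
  (P : probability T R).

Lemma measurable_RV_tuple (I : Type) (Z : I -> {RV P >-> R}) n (t : n.-tuple I) :
  measurable_fun setT
    (fun w => map_tuple (fun k => Z k w : measurableTypeR R) t).
Proof.
apply/measurable_fun_tnthP => i /=.
rewrite (_ : _ \o _ = Z (tnth t i)); last by apply/funext => w; rewrite /= tnth_map.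
by move=> _ B mB; exact: (@measurable_funP _ _ _ _ setT (Z (tnth t i)) measurableT B mB).
Qed.

Lemma measurable_tnth_real n (i : 'I_n) : measurable_fun setT
  ((fun y => tnth y i) : n.-tuple (measurableTypeR R) -> R).
Proof. by move=> _ B mB; exact: (@measurable_tnth _ (measurableTypeR R) n i measurableT B mB). Qed.

End tuples.

(** * Factorization of characteristic functions over blocks *)

Section blocks.
Context (R : realType) (d d' : measure_display)
  (T : measurableType d) (T' : measurableType d')
  (P : probability T R) (P' : probability T' R)
  (Y : nat -> {RV P >-> R}) (X : int -> {RV P' >-> R}).
Hypothesis YX : two_sided_extension Y X.
Hypothesis Ystat : strongly_stationary Y.
Implicit Types (p q m r N : nat) (c : nat -> R) (th : R) (U : T -> R).

(** Both sides are the characteristic function of the same linear form, and the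
    two vectors of variables have the same law: extend Y to the integers, then
    shift time by p.  This moves the mixing coefficient of the two-sided
    extension to an arbitrary position p in the original sequence. *)
Lemma charfun_transfer c N p :
  charfun P (fun w => \sum_(1 <= k < N.+1) c k * Y k w) =
  charfun P' (fun w => \sum_(1 <= k < N.+1) c k * X (k%:Z - p%:Z) w).
Proof.
have [Xstat XY] := YX.
pose t : N.-tuple nat := [tuple of iota 1 N].
pose f1 w : N.-tuple (measurableTypeR R) :=
  map_tuple (fun k => Y k w : measurableTypeR R) t.
pose t' : N.-tuple int := map_tuple (+%R (- p%:Z)) (map_tuple Posz t).
pose f2 w : N.-tuple (measurableTypeR R) :=
  map_tuple (fun k => X k w : measurableTypeR R) t'.
have m1 : measurable_fun setT f1 by exact: measurable_RV_tuple.
have m2 : measurable_fun setT f2 by exact: measurable_RV_tuple.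
have law A : measurable A -> P (f1 @^-1` A) = P' (f2 @^-1` A).
  move=> mA; have t1 : all (leq 1) t.
    by apply/allP => k; rewrite mem_iota => /andP[].
  have := Xstat N (- p%:Z) (map_tuple Posz t) A mA.
  by rewrite (XY _ _ t1 _ mA).
pose L (y : N.-tuple (measurableTypeR R)) : R := \sum_(i < N) c i.+1 * tnth y i.
have mL : measurable_fun setT L.
  apply: measurable_sum => i; apply: measurable_funM; first exact: measurable_cst.
  exact: measurable_tnth_real.
have L1 w : \sum_(1 <= k < N.+1) c k * Y k w = L (f1 w).
  rewrite big_add1 /= big_mkord; apply: eq_bigr => i _.
  by rewrite tnth_map (tnth_nth 0%N) /= nth_iota// add1n.
have L2 w : \sum_(1 <= k < N.+1) c k * X (k%:Z - p%:Z) w = L (f2 w).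
  rewrite big_add1 /= big_mkord; apply: eq_bigr => i _.
  by rewrite !tnth_map (tnth_nth 0%N) /= nth_iota// add1n addrC.
rewrite !charfunE; congr Complex.
  under eq_Rintegral do rewrite L1; under [RHS]eq_Rintegral do rewrite L2.
  apply: (same_law_Rint (g := fun y => cos (L y)) m1 m2 law) => [|x].
    exact: (measurableT_comp (@measurable_cos R)).
  exact: cos_max.
under eq_Rintegral do rewrite L1; under [RHS]eq_Rintegral do rewrite L2.
apply: (same_law_Rint (g := fun y => sin (L y)) m1 m2 law) => [|x].
  exact: (measurableT_comp (@measurable_sin R)).
exact: sin_max.
Qed.

Definition trunc_moment th := \int[P]_w Num.min `|th * Y 1%N w| 2.

Lemma measurable_Yz th k : measurable_fun setT (fun w => th * Y k w).
Proof. by apply: measurable_funM => //; exact: measurable_funPT. Qed.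

Lemma trunc_momentE th k : (0 < k)%N ->
  \int[P]_w Num.min `|th * Y k w| 2 = trunc_moment th.
Proof.
move=> k0; pose t : 1.-tuple nat := [tuple 1%N].
pose f (t : 1.-tuple nat) w : 1.-tuple (measurableTypeR R) :=
  map_tuple (fun k => Y k w : measurableTypeR R) t.
have mf s : measurable_fun setT (f s) by exact: measurable_RV_tuple.
pose g (y : 1.-tuple (measurableTypeR R)) : R := Num.min `|th * tnth y ord0| 2.
have mg : measurable_fun setT g.
  apply: measurable_minr => //; apply: measurableT_comp => //.
  by apply: measurable_funM => //; exact: measurable_tnth_real.
have gM y : `|g y| <= 2.
  by rewrite /g ger0_norm ?ge_min ?lexx ?orbT.
have := same_law_Rint (mf (map_tuple (addn k.-1) t)) (mf t)
   (fun A mA => @Ystat 1 k.-1 t isT A mA) mg gM.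
by rewrite /g /f /t /trunc_moment /tnth /= addn1 prednK.
Qed.

Lemma trunc_moment_ge0 th : 0 <= trunc_moment th.
Proof. by apply: Rintegral_ge0 => w _; rewrite le_min normr_ge0 ler0n. Qed.

Definition segment p q w := \sum_(p.+1 <= k < q.+1) Y k w.

Lemma segmentE p q w : (p <= q)%N ->
  partial_sum Y q w - partial_sum Y p w = segment p q w.
Proof.
move=> pq; rewrite /partial_sum (@big_cat_nat _ _ _ p.+1 1 q.+1)//=.
by rewrite addrAC subrr add0r.
Qed.

Lemma measurable_segment p q : measurable_fun setT (segment p q).
Proof. by apply: measurable_sum => k; exact: measurable_funPT. Qed.

Lemma min2_sum I (s : seq I) (F : I -> R) :
  Num.min `|\sum_(i <- s) F i| 2 <= \sum_(i <- s) Num.min `|F i| 2.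
Proof.
elim: s => [|i s IH]; first by rewrite !big_nil normr0 ge_min lexx.
rewrite !big_cons.
have H (x y : R) : Num.min `|x + y| 2 <= Num.min `|x| 2 + Num.min `|y| 2.
  have := ler_normD x y; have := normr_ge0 x; have := normr_ge0 y.
  rewrite ge_min /Num.min; case: ifPn; case: ifPn; rewrite -?leNgt => h1 h2 h3 h4 h5;
    apply/orP; by [left; lra|right; lra].
by apply: le_trans (H _ _) _; rewrite lerD2l.
Qed.

(** The truncation |.| /\ 2 is subadditive, so the [q - p] added terms contribute
    separately, and equally by stationarity. *)
Lemma charfun_segment U th p q : measurable_fun setT U -> (p <= q)%N ->
  Normc.normc (charfun P (fun w => U w + th * segment p q w) - charfun P U) <=
    2 * (q - p)%:R * trunc_moment th.
Proof.
move=> mU pq.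
apply: le_trans (charfun_perturb P mU _) _.
  by apply: measurable_funM => //; exact: measurable_segment.
rewrite -mulrA ler_pM2l//.
have b i : bounded_mfun (fun w => Num.min `|th * Y i w| 2).
  by apply: bounded_mfun_min; exact: measurable_Yz.
have -> : (q - p)%:R * trunc_moment th =
    \int[P]_w \sum_(p.+1 <= k < q.+1) Num.min `|th * Y k w| 2.
  rewrite Rint_sum// big_nat_cond (eq_bigr (fun=> trunc_moment th)).
    by rewrite -big_nat_cond sumr_const_nat subSS mulr_natl.
  by move=> k /andP[/andP[pk _] _]; rewrite trunc_momentE// (leq_trans _ pk).
apply: le_Rint; [|exact: bounded_mfun_sum|].
  apply: bounded_mfun_min; apply: measurable_funM => //; exact: measurable_segment.
by move=> w; rewrite mulr_sumr; exact: min2_sum.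
Qed.

(** Having a linear form in Y_1, ..., Y_p, and not just some measurable function
    of them, is what lets [charfun_transfer] act on it. *)
Definition past p U :=
  exists c, U = (fun w => \sum_(1 <= k < p.+1) c k * Y k w).

Lemma measurable_past p U : past p U -> measurable_fun setT U.
Proof.
by move=> [c ->]; apply: measurable_sum => k; exact: measurable_Yz.
Qed.

Lemma past0 : past 0 (fun=> 0).
Proof. by exists (fun=> 0); apply/funext => w; rewrite big_geq. Qed.

Lemma past_segment p q U th : (p <= q)%N -> past p U ->
  past q (fun w => U w + th * segment p q w).
Proof.
move=> pq [c ->]; exists (fun k => if (k <= p)%N then c k else th).
apply/funext => w; rewrite (@big_cat_nat _ _ _ p.+1 1 q.+1)//=; congr (_ + _).
  by apply: eq_big_nat => k /andP[_ kp]; rewrite -ltnS kp.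
rewrite mulr_sumr; apply: eq_big_nat => k /andP[pk _].
by rewrite leqNgt pk.
Qed.

(** Shifting time by -p sends the past to indices <= 0 and the segment after the
    gap to indices > r; without the past, the same segment has the law of the
    one from r to m. *)
Lemma charfun_gap p r m U th : past p U -> (r <= m)%N ->
  Normc.normc (charfun P (fun w => U w + th * segment (p + r) (p + m) w) -
    charfun P U * charfun P (fun w => th * segment r m w)) <=
  16 * mixing_coef X r.
Proof.
move=> [c ->] rm.
(* Both linear forms are rewritten over the common range 1, ..., p + m, so that
   a single change of law applies to their sum. *)
pose cU k := if (k <= p)%N then c k else 0.
pose cV k := if (p + r < k)%N then th else 0.
have cUE w : \sum_(1 <= k < p.+1) c k * Y k w =
    \sum_(1 <= k < (p + m).+1) cU k * Y k w.
  rewrite [RHS](@big_cat_nat _ _ _ p.+1)//=; last by rewrite ltnS leq_addr.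
  rewrite [X in _ = _ + X]big_nat_cond [X in _ = _ + X]big1 ?addr0.
    by apply: eq_big_nat => k /andP[_ kp]; rewrite /cU -ltnS kp.
  by move=> k /andP[/andP[pk _] _]; rewrite /cU leqNgt pk mul0r.
have cVE w : th * segment (p + r) (p + m) w =
    \sum_(1 <= k < (p + m).+1) cV k * Y k w.
  rewrite [RHS](@big_cat_nat _ _ _ (p + r).+1)//=; last by rewrite ltnS leq_add2l.
  rewrite [X in _ = X + _]big_nat_cond [X in _ = X + _]big1 ?add0r.
    by rewrite mulr_sumr; apply: eq_big_nat => k /andP[pk _]; rewrite /cV pk.
  by move=> k /andP[/andP[_ pk] _]; rewrite /cV ltnNge -ltnS pk mul0r.
have -> : (fun w => \sum_(1 <= k < p.+1) c k * Y k w +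
    th * segment (p + r) (p + m) w) =
    (fun w => \sum_(1 <= k < (p + m).+1) (cU k + cV k) * Y k w).
  apply/funext => w; rewrite cUE cVE -big_split /=.
  by apply: eq_bigr => k _; rewrite mulrDl.
pose V' w := \sum_((p + r).+1 <= k < (p + m).+1) th * X (k%:Z - p%:Z) w.
have -> : charfun P (fun w => th * segment r m w) = charfun P' V'.
  pose c0 k := if (r < k)%N then th else 0.
  have -> : (fun w => th * segment r m w) =
      (fun w => \sum_(1 <= k < m.+1) c0 k * Y k w).
    apply/funext => w.
    rewrite [RHS](@big_cat_nat _ _ _ r.+1)//=.
    rewrite [X in _ = X + _]big_nat_cond [X in _ = X + _]big1 ?add0r.
      by rewrite mulr_sumr; apply: eq_big_nat => k /andP[pk _]; rewrite /c0 pk.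
    by move=> k /andP[/andP[_ pk] _]; rewrite /c0 ltnNge -ltnS pk mul0r.
  rewrite (charfun_transfer _ _ 0); congr charfun; apply/funext => w.
  rewrite (@big_cat_nat _ _ _ r.+1)//=.
  rewrite [X in X + _ = _]big_nat_cond [X in X + _ = _]big1 ?add0r; last first.
    by move=> k /andP[/andP[_ pk] _]; rewrite /c0 ltnNge -ltnS pk mul0r.
  rewrite /V' -!addnS addnC (addnC p) big_addn addnK.
  apply: eq_big_nat => k /andP[pk _]; rewrite /c0 pk subr0.
  by rewrite PoszD addrK.
rewrite (funext cUE) !(charfun_transfer _ _ p).
pose U' w := \sum_(1 <= k < p.+1) c k * X (k%:Z - p%:Z) w.
have -> : (fun w => \sum_(1 <= k < (p + m).+1) cU k * X (k%:Z - p%:Z) w) = U'.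
  apply/funext => w.
  rewrite [LHS](@big_cat_nat _ _ _ p.+1)//=; last by rewrite ltnS leq_addr.
  rewrite [X in _ + X = _]big_nat_cond [X in _ + X = _]big1 ?addr0.
    by apply: eq_big_nat => k /andP[_ kp]; rewrite /cU -ltnS kp.
  by move=> k /andP[/andP[pk _] _]; rewrite /cU leqNgt pk mul0r.
have -> : (fun w => \sum_(1 <= k < (p + m).+1) (cU k + cV k) * X (k%:Z - p%:Z) w) =
    (fun w => U' w + V' w).
  apply/funext => w.
  rewrite [LHS](@big_cat_nat _ _ _ p.+1)//=; last by rewrite ltnS leq_addr.
  congr (_ + _).
    apply: eq_big_nat => k /andP[_ kp]; rewrite /cU /cV -ltnS kp.
    by rewrite ltnNge (leq_trans _ (leq_addr _ _)) ?addr0// -ltnS.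
  rewrite [LHS](@big_cat_nat _ _ _ (p + r).+1)//=;
    [|by rewrite ltnS leq_addr|by rewrite ltnS leq_add2l].
  rewrite [X in X + _ = _]big_nat_cond [X in X + _ = _]big1 ?add0r.
    apply: eq_big_nat => k /andP[pk _]; rewrite /cU /cV pk leqNgt.
    by rewrite (leq_trans _ pk) ?add0r// ltnS leq_addr.
  move=> k /andP[/andP[pk kr] _].
  by rewrite /cU /cV leqNgt pk ltnNge -ltnS kr addr0 mul0r.
apply: (charfun_cov (F := sigma_algebra_of X [set k | k <= 0])
   (G := sigma_algebra_of X [set k | r%:Z <= k])).
- by apply: measurable_sum => k; exact: measurable_funM.
- by apply: measurable_sum => k; exact: measurable_funM.
- move=> B mB; apply: sigma_algebra_of_sum => // k.
  by rewrite mem_index_iota /= => /andP[_ kp]; rewrite subr_le0 lez_nat -ltnS.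
- move=> B mB; apply: sigma_algebra_of_sum => // k.
  rewrite mem_index_iota /= => /andP[pk _].
  by rewrite lerBrDl -PoszD lez_nat ltnW.
- move=> A B; exact: mixing_coef_ub.
Qed.

End blocks.

Section complex_norm.
Context (R : realType).

Lemma normc_ge0 (z : R[i]) : 0 <= Normc.normc z.
Proof. by case: z => x y; exact: sqrtr_ge0. Qed.

Lemma normcX_le1 (z : R[i]) n : Normc.normc z <= 1 -> Normc.normc (z ^+ n) <= 1.
Proof.
move=> z1; elim: n => [|n IH]; first by rewrite expr0 Normc.normc1.
by rewrite exprS Normc.normcM mulr_ile1 ?normc_ge0.
Qed.

End complex_norm.

Section block_products.
Context (R : realType) (d d' : measure_display)
  (T : measurableType d) (T' : measurableType d')
  (P : probability T R) (P' : probability T' R)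
  (Y : nat -> {RV P >-> R}) (X : int -> {RV P' >-> R}).
Hypothesis YX : two_sided_extension Y X.
Hypothesis Ystat : strongly_stationary Y.
Implicit Types (p q m r N : nat) (c : nat -> R) (th : R) (U : T -> R).
Let normc := (@Normc.normc R).
Let charfun := (@charfun R d T P).

(** The first [r] terms of the block are deleted twice: in the joint
    characteristic function, where this opens the gap, and in the factor of the
    isolated block, where it undoes the effect. *)
Lemma charfun_block p r m U th : past Y p U -> (r <= m)%N ->
  normc (charfun (fun w => U w + th * segment Y p (p + m) w) -
    charfun U * charfun (fun w => th * segment Y 0 m w)) <=
  4 * r%:R * trunc_moment Y th + 16 * mixing_coef X r.
Proof.
move=> pU rm; have mU := measurable_past pU.
pose V := fun w => U w + th * segment Y (p + r) (p + m) w.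
have mV : measurable_fun setT V.
  by apply: measurable_funD => //; apply: measurable_funM => //; exact: measurable_segment.
have split_seg q w : th * segment Y q (q + m) w =
    th * segment Y (q + r) (q + m) w + th * segment Y q (q + r) w.
  rewrite -mulrDr addrC /segment -big_cat_nat//= ltnS ?leq_addr//.
  by rewrite leq_add2l.
have -> : (fun w => U w + th * segment Y p (p + m) w) =
    (fun w => V w + th * segment Y p (p + r) w).
  by apply/funext => w; rewrite split_seg addrA.
have mW : measurable_fun setT (fun w => th * segment Y r m w).
  by apply: measurable_funM => //; exact: measurable_segment.
have -> : (fun w => th * segment Y 0 m w) =
    (fun w => th * segment Y r m w + th * segment Y 0 r w).
  by apply/funext => w; have := split_seg 0%N w; rewrite !add0n.
have H1 := charfun_segment Ystat th mV (leq_addr r p).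
have H2 := charfun_segment Ystat th mW (leq0n r).
have H3 := charfun_gap YX th pU rm.
rewrite addKn in H1; rewrite subn0 in H2.
set a := charfun _; set b := charfun U; set e := charfun _.
rewrite -/charfun in H1 H2 H3.
rewrite [X in normc X](_ : _ = (a - charfun V) +
   (charfun V - b * charfun (fun w => th * segment Y r m w)) +
   - (b * (e - charfun (fun w => th * segment Y r m w)))); last by ring.
apply: le_trans (le_normcD _ _) _.
apply: le_trans (lerD (le_normcD _ _) (lexx _)) _.
rewrite normcN Normc.normcM.
have Hb : Normc.normc b <= 1 by exact: normc_charfun_le1.
have b0 := normc_ge0 b.
have e0 : 0 <= Normc.normc (e - charfun (fun w => th * segment Y r m w)).
  exact: normc_ge0.
have : Normc.normc b * Normc.normc (e - charfun (fun w => th * segment Y r m w))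
   <= 1 * (2 * r%:R * trunc_moment Y th) by rewrite ler_pM.
by move: H1 H3; rewrite -/a /normc; lra.
Qed.

(** Each new block is split off with everything before it, the earlier blocks
    included, as its past; as all factors have modulus at most 1, the errors
    add up. *)
Lemma charfun_blocks p r m k U th : past Y p U -> (r <= m)%N ->
  normc (charfun (fun w => U w + th * segment Y p (p + k * m) w) -
    charfun U * charfun (fun w => th * segment Y 0 m w) ^+ k) <=
  k%:R * (4 * r%:R * trunc_moment Y th + 16 * mixing_coef X r).
Proof.
move=> pU rm; elim: k => [|k IH].
  rewrite mul0n addn0 expr0 mulr1 mul0r.
  rewrite (_ : (fun w => _) = U) ?subrr ?[normc _]Normc.normc0//.
  by apply/funext => w; rewrite /segment big_geq// mulr0 addr0.
pose V := fun w => U w + th * segment Y p (p + k * m) w.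
have pV : past Y (p + k * m) V by apply: past_segment => //; exact: leq_addr.
have := charfun_block th pV rm.
rewrite (_ : (fun w => V w + _) =
  (fun w => U w + th * segment Y p (p + k.+1 * m) w)); last first.
  apply/funext => w; rewrite /V -addrA -mulrDr; congr (_ + _ * _).
  rewrite /segment -big_cat_nat//= ?ltnS ?leq_addr//.
  by rewrite mulSn (addnC m) addnA.
set a := charfun _; set b := charfun V; set e := charfun _ => H.
have e1 : Normc.normc e <= 1.
  apply: normc_charfun_le1; apply: measurable_funM => //.
  exact: measurable_segment.
rewrite [X in normc X](_ : _ = (a - b * e) + (b - charfun U * e ^+ k) * e); last first.
  by rewrite exprSr; ring.
apply: le_trans (le_normcD _ _) _; rewrite Normc.normcM -natr1 mulrDl mul1r addrC.
apply: lerD => //; rewrite -[leRHS]mulr1 ler_pM ?normc_ge0//.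
Qed.

(** The last term of the bound pays for the incomplete block at the end of the
    segment. *)
Lemma charfun_segment_blocks p q r m U th : past Y p U -> (r <= m)%N ->
    (0 < m)%N -> (p <= q)%N ->
  normc (charfun (fun w => U w + th * segment Y p q w) -
    charfun U * charfun (fun w => th * segment Y 0 m w) ^+ ((q - p) %/ m)) <=
  ((q - p) %/ m)%:R * (4 * r%:R * trunc_moment Y th + 16 * mixing_coef X r)
    + 2 * m%:R * trunc_moment Y th.
Proof.
move=> pU rm m0 pq; set k := ((q - p) %/ m)%N.
have km : (p + k * m <= q)%N by rewrite -leq_subRL// leq_divM.
pose V := fun w => U w + th * segment Y p (p + k * m) w.
have mV : measurable_fun setT V.
  apply: measurable_funD; first exact: measurable_past pU.
  by apply: measurable_funM => //; exact: measurable_segment.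
have := charfun_segment Ystat th mV km.
rewrite (_ : (fun w => V w + _) = (fun w => U w + th * segment Y p q w)); last first.
  apply/funext => w; rewrite /V -addrA -mulrDr; congr (_ + _ * _).
  by rewrite /segment -big_cat_nat//= ltnS ?leq_addr.
move=> H; have H2 := charfun_blocks k th pU rm.
set z := charfun _; rewrite (_ : z - _ = (z - charfun V) + (charfun V -
   charfun U * charfun (fun w => th * segment Y 0 m w) ^+ k)); last by ring.
apply: le_trans (le_normcD _ _) _; rewrite addrC; apply: lerD; first exact: H2.
apply: le_trans H _; rewrite ler_wpM2r ?trunc_moment_ge0// ler_pM2l// ler_nat.
have := divn_eq (q - p) m; have := ltn_pmod (q - p) m0; rewrite -/k; lia.
Qed.

Lemma joint_charfun_blocks (js : nat -> nat) (ths : nat -> R) r m l :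
    js 0%N = 0%N -> (forall i, (i < l)%N -> (js i <= js i.+1)%N) ->
    (r <= m)%N -> (0 < m)%N ->
  normc (charfun (fun w => \sum_(i < l) ths i * segment Y (js i) (js i.+1) w) -
    \prod_(i < l) charfun (fun w => ths i * segment Y 0 m w)
       ^+ ((js i.+1 - js i) %/ m)) <=
  \sum_(i < l) (((js i.+1 - js i) %/ m)%:R *
      (4 * r%:R * trunc_moment Y (ths i) + 16 * mixing_coef X r)
    + 2 * m%:R * trunc_moment Y (ths i)).
Proof.
move=> js0 jsS rm m0.
have pastW k : (k <= l)%N ->
    past Y (js k) (fun w => \sum_(i < k) ths i * segment Y (js i) (js i.+1) w).
  elim: k => [|k IH] kl.
    rewrite js0 (_ : (fun w => _) = (fun=> 0)); first exact: past0.
    by apply/funext => w; rewrite big_ord0.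
  under eq_fun do rewrite big_ord_recr /=.
  by apply: past_segment; [exact: jsS|apply: IH; exact: ltnW].
suff H k : (k <= l)%N ->
  normc (charfun (fun w => \sum_(i < k) ths i * segment Y (js i) (js i.+1) w) -
    \prod_(i < k) charfun (fun w => ths i * segment Y 0 m w)
       ^+ ((js i.+1 - js i) %/ m)) <=
  \sum_(i < k) (((js i.+1 - js i) %/ m)%:R *
      (4 * r%:R * trunc_moment Y (ths i) + 16 * mixing_coef X r)
    + 2 * m%:R * trunc_moment Y (ths i)) by exact: H.
elim: k => [|k IH] kl.
  rewrite !big_ord0 (_ : charfun _ = 1) ?subrr ?[normc _]Normc.normc0//.
  rewrite /charfun charfunE.
  under eq_Rintegral do rewrite big_ord0 cos0.
  under [X in Complex _ X]eq_Rintegral do rewrite big_ord0 sin0.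
  by rewrite !Rint_cst.
have H := charfun_segment_blocks (ths k) (pastW k (ltnW kl)) rm m0 (jsS k kl).
under eq_fun do rewrite big_ord_recr /=.
rewrite !big_ord_recr /=.
set z := charfun _; pose u := charfun (fun w => \sum_(i < k) ths i * segment Y (js i) (js i.+1) w).
set b := \prod_(i < k) _; set e := _ ^+ _.
rewrite (_ : z - _ = (u - b) * e + (z - u * e)); last by ring.
apply: le_trans (le_normcD _ _) _; apply: lerD => //.
rewrite Normc.normcM -[leRHS]mulr1 ler_pM ?normc_ge0//; first by apply: IH; exact: ltnW.
apply: normcX_le1; apply: normc_charfun_le1; apply: measurable_funM => //.
exact: measurable_segment.
Qed.

(** [j] prefixed with j_0 = 0 is read through [nth], so that the increments are
    consecutive segments and [joint_charfun_blocks] applies. *)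
Lemma phiE (a : nat -> R) n k (j : k.-tuple nat) (theta : k.-tuple R) :
    path leq 0%N j ->
  phi Y a n j theta = charfun (fun w => \sum_(i < k)
    ((a n)^-1 * theta`_i) * segment Y (nth 0%N (0%N :: j) i) (nth 0%N (0%N :: j) i.+1) w).
Proof.
move=> pj; rewrite /phi; congr complex_expectation; apply/funext => w; congr expi.
rewrite mulr_sumr; apply: eq_bigr => i _; rewrite mulrA (tnth_nth 0) (tnth_nth 0%N) /=.
congr (_ * _); rewrite segmentE//.
have := pathP 0%N pj; move=> /(_ i); rewrite size_tuple; apply; exact: ltn_ord.
Qed.

End block_products.

(** * Convergence of real sequences *)

Section real_sequences.
Context (R : realType).

(** Lets the limit be computed after the limit theorems have been applied. *)
Lemma cvg_limE (f : nat -> R) (x y : R) :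
  f n @[n --> \oo] --> x -> x = y -> f n @[n --> \oo] --> y.
Proof. by move=> fx <-. Qed.

Lemma powRV (x b : R) : 0 < x -> x^-1 `^ b = (x `^ b)^-1.
Proof. by move=> x0; rewrite -(powR_inv1 (ltW x0)) -powRrM mulN1r powRN. Qed.

Lemma cvg0_sum (I : Type) (s : seq I) (f : I -> nat -> R) :
  (forall i, f i n @[n --> \oo] --> 0) ->
  (\sum_(i <- s) f i n) @[n --> \oo] --> (0 : R).
Proof.
move=> f0; elim: s => [|i s IH].
  by under eq_fun do rewrite big_nil; exact: cvg_cst.
under eq_fun do rewrite big_cons.
by apply: (cvg_limE (x := 0 + 0)); [exact: cvgD|rewrite addr0].
Qed.

Lemma cvgny_divn (m : nat -> nat) :
  m n @[n --> \oo] --> \oo -> (m n)%:R / n%:R @[n --> \oo] --> (0 : R) ->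
  (n %/ m n)%N @[n --> \oo] --> \oo.
Proof.
move=> /cvgnyPge moo /cvgr0Pnorm_le mn0; apply/cvgnyPge => A.
have A0 : 0 < A.+1%:R^-1 :> R by rewrite invr_gt0 ltr0n.
near=> n.
have m0 : (0 < m n)%N by near: n; exact: moo.
have n0 : (0 < n)%N by near: n; exact: nbhs_infty_gt.
rewrite leq_divRL//.
have : `|(m n)%:R / n%:R : R| <= A.+1%:R^-1 by near: n; exact: mn0.
rewrite ger0_norm ?divr_ge0// ler_pdivrMr ?ltr0n// mulrC ler_pdivlMr ?ltr0n//.
rewrite -natrM ler_nat; apply: leq_trans.
by rewrite mulnC leq_mul2l leqnSn orbT.
Unshelve. all: by end_near. Qed.

End real_sequences.

(** * Tails, truncated moments and norming sequence *)

Section tail.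
Context (R : realType) (d : measure_display) (T : measurableType d)
  (P : probability T R) (Z : {RV P >-> R}) (alpha : R).

Let tail (x : R) := fine (P [set w | x < `|Z w|]).

Lemma measurable_tail_event x : measurable [set w | x < `|Z w|].
Proof.
have mZ : measurable_fun setT (fun w => `|Z w|) by exact: measurableT_comp.
rewrite -[X in measurable X]setTI (_ : [set w | _] = (fun w => `|Z w|) @^-1` `]x, +oo[).
  exact: mZ.
by apply/seteqP; split => w /=; rewrite in_itv /= andbT.
Qed.

Lemma tail_le x y : x <= y -> tail y <= tail x.
Proof.
move=> xy; apply: fine_le; try by apply: fin_num_measure; exact: measurable_tail_event.
apply: le_measure; rewrite ?inE; try exact: measurable_tail_event.
by move=> w /=; exact: le_lt_trans.
Qed.

Lemma tail_le1 x : tail x <= 1.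
Proof.
rewrite -[leRHS]/(fine 1%:E) fine_le//.
  by apply: fin_num_measure; exact: measurable_tail_event.
by apply: probability_le1; exact: measurable_tail_event.
Qed.

Lemma tail_ge0 x : 0 <= tail x.
Proof. by apply: fine_ge0; exact: measure_ge0. Qed.

Hypothesis rv : regularly_varying Z alpha.

Lemma tail_gt0 x : 0 < x -> 0 < tail x.
Proof. by case: rv => _ H _ _; exact: H. Qed.

Lemma tail_doubling : tail (2 * x) / tail x @[x --> +oo] --> 2 `^ (- alpha).
Proof. by case: rv => _ _ H _; exact: H. Qed.

(** Every x >= x0 is brought into [x0, 2 x0] by halving. *)
Lemma doubling_bounded (g : R -> R) (x0 M : R) : 0 < x0 ->
  (forall x, x0 <= x -> g (2 * x) <= g x) ->
  (forall x, x0 <= x <= 2 * x0 -> g x <= M) ->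
  forall x, x0 <= x -> g x <= M.
Proof.
move=> x0_gt0 g2 gM.
have H k x : x0 <= x <= 2 ^+ k.+1 * x0 -> g x <= M.
  elim: k x => [|k IH] x; first by rewrite expr1; exact: gM.
  move=> /andP[xl xu]; have [xx0|xx0] := leP x (2 * x0).
    by apply: gM; rewrite xl.
  rewrite (_ : x = 2 * (x / 2)); last by field.
  apply: le_trans (g2 _ _) (IH _ _); first by lra.
  apply/andP; split; first by lra.
  by move: xu; rewrite exprS; lra.
move=> x xl; pose k := Num.truncn (x / x0).
have xk : x <= k.+1%:R * x0 by rewrite -ler_pdivrMr// ltW// truncnS_gt.
apply: (H k); rewrite xl /= (le_trans xk)// ler_pM2r//.
by rewrite -natrX ler_nat ltnW// ltn_expl.
Qed.

(** Potter's upper bound, in the crude form needed here: the ratio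
    tail(2 x) / tail(x) tends to 2^(-alpha) < 2^(-b), hence x^b tail(x)
    decreases along doublings. *)
Lemma tail_upper (b : R) : 0 <= b < alpha ->
  exists C x0 : R, [/\ 0 <= C, 0 < x0 & forall x, x0 <= x -> tail x <= C * x `^ (- b)].
Proof.
move=> /andP[b0 ba].
have lt2 : 2 `^ (- alpha) < 2 `^ (- b) :> R.
  by rewrite !powRN ltf_pV2 ?posrE ?powR_gt0// /powR ifF ?gt_eqF//
    ltr_expR ltr_pM2r ?ln_gt0 ?ltr1n.
have [x0 [x0real Hx0]] : \forall x \near +oo, tail (2 * x) / tail x <= 2 `^ (- b).
  exact: (cvgr_le _ tail_doubling).
pose x1 := Num.max (x0 + 1) 1.
have x1_gt0 : 0 < x1 by rewrite lt_max ltr01 orbT.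
have x01 x : x1 <= x -> x0 < x.
  by rewrite ge_max => /andP[h _]; apply: lt_le_trans h; rewrite ltrDl.
exists ((2 * x1) `^ b), x1; split => //; first exact: powR_ge0.
have H := @doubling_bounded (fun x => x `^ b * tail x) x1 ((2 * x1) `^ b) x1_gt0.
move=> x xx1; have x_gt0 : 0 < x by exact: lt_le_trans xx1.
rewrite powRN ler_pdivlMr ?powR_gt0// mulrC.
apply: (H _ _ x xx1) => y.
  move=> y1; have y_gt0 : 0 < y by exact: lt_le_trans y1.
  have := Hx0 y (x01 _ y1); rewrite ler_pdivrMr ?tail_gt0// powRN.
  rewrite (powRM _ (ler0n R 2) (ltW y_gt0)) => h.
  rewrite -mulrA mulrCA ler_wpM2l ?powR_ge0//.
  by rewrite -ler_pdivlMl ?powR_gt0.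
move=> /andP[y1 y2].
rewrite -[leRHS]mulr1 ler_pM ?powR_ge0 ?tail_ge0 ?tail_le1//.
by rewrite ge0_ler_powR ?nnegrE// ?mulr_ge0 ?ltW// (lt_le_trans x1_gt0).
Qed.

(** Potter's lower bound: now x^(-l) / tail(x) decreases along doublings. *)
Lemma tail_lower (l : R) : alpha < l ->
  exists c x0 : R, [/\ 0 < c, 0 < x0 & forall x, x0 <= x -> c * x `^ (- l) <= tail x].
Proof.
move=> al; have a0 : 0 < alpha by case: rv.
have lt2 : 2 `^ (- l) < 2 `^ (- alpha) :> R.
  by rewrite !powRN ltf_pV2 ?posrE ?powR_gt0// /powR ifF ?gt_eqF//
    ltr_expR ltr_pM2r ?ln_gt0 ?ltr1n.
have [x0 [x0real Hx0]] : \forall x \near +oo, 2 `^ (- l) <= tail (2 * x) / tail x.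
  exact: (cvgr_ge _ tail_doubling).
pose x1 := Num.max (x0 + 1) 1.
have x1_gt0 : 0 < x1 by rewrite lt_max ltr01 orbT.
have x01 x : x1 <= x -> x0 < x.
  by rewrite ge_max => /andP[h _]; apply: lt_le_trans h; rewrite ltrDl.
have t2 : 0 < tail (2 * x1) by rewrite tail_gt0// mulr_gt0.
pose M := x1 `^ (- l) / tail (2 * x1).
have M0 : 0 < M by rewrite divr_gt0 ?powR_gt0.
exists M^-1, x1; split => //; first by rewrite invr_gt0.
have H := @doubling_bounded (fun x => x `^ (- l) / tail x) x1 M x1_gt0.
move=> x xx1; have x_gt0 : 0 < x by exact: lt_le_trans xx1.
rewrite ler_pdivrMl// -ler_pdivrMr ?tail_gt0//.
apply: (H _ _ x xx1) => y.
  move=> y1; have y_gt0 : 0 < y by exact: lt_le_trans y1.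
  have := Hx0 y (x01 _ y1); rewrite ler_pdivlMr ?tail_gt0// => h.
  rewrite (powRM _ (ler0n R 2) (ltW y_gt0)) ler_pdivrMr ?tail_gt0 ?mulr_gt0// mulrAC.
  rewrite ler_pdivlMr ?tail_gt0// mulrAC mulrC ler_wpM2l ?powR_ge0//.
move=> /andP[y1 y2]; have y_gt0 : 0 < y by exact: lt_le_trans y1.
rewrite ler_pM ?powR_ge0 ?invr_ge0 ?tail_ge0//.
  rewrite !powRN lef_pV2 ?posrE ?powR_gt0//.
  by rewrite ge0_ler_powR ?nnegrE ?(ltW x1_gt0) ?(ltW y_gt0)// ltW// (lt_trans a0).
by rewrite lef_pV2 ?posrE ?(tail_gt0 y_gt0)// tail_le.
Qed.

Lemma powRXn (x b : R) k : 0 <= x -> (x ^+ k) `^ b = (x `^ b) ^+ k.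
Proof.
move=> x0; rewrite -(powR_mulrn k x0) -(powR_mulrn k (powR_ge0 x b)).
exact: powRAC.
Qed.

Lemma min2_le_powR (x b : R) : 0 <= x -> 0 < b <= 1 -> Num.min x 2 <= 2 * x `^ b.
Proof.
move=> x0 /andP[b0 b1]; have [->|xn0] := eqVneq x 0.
  by rewrite powR0 ?gt_eqF// mulr0 ge_min lexx.
have xgt0 : 0 < x by rewrite lt_neqAle eq_sym xn0.
rewrite ge_min; apply/orP; have [x1|x1] := leP x 1.
  left; apply: le_trans (ger1_powR _ b1) _; first by rewrite xgt0.
  by rewrite ler_peMl ?powR_ge0// ler1n.
right; rewrite ler_peMr// -[leLHS](powRr0 x) ler_powR ?ltW//.
Qed.

(** If z > x0, only the last dyadic level 2^k x0 below z is needed, and its term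
    alone exceeds z^b. *)
Lemma powR_le_dyadic (z x0 b : R) K : 0 <= z -> 0 < x0 -> 0 < b ->
  z <= 2 ^+ K * x0 ->
  z `^ b <= x0 `^ b +
    \sum_(k < K) (2 ^+ k.+1 * x0) `^ b * (2 ^+ k * x0 < z)%R%:R.
Proof.
move=> z0 x00 b0; elim: K => [|K IH] zK.
  rewrite big_ord0 addr0 ge0_ler_powR ?nnegrE ?(ltW b0) ?(ltW x00)//.
  by move: zK; rewrite expr0 mul1r.
rewrite big_ord_recr /=; have [zK'|zK'] := leP z (2 ^+ K * x0).
  by rewrite mulr0 addr0; exact: IH.
rewrite mulr1 addrA -[leLHS]add0r; apply: lerD; last first.
  by rewrite ge0_ler_powR ?nnegrE ?(ltW b0)// mulr_ge0 ?exprn_ge0 ?(ltW x00).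
by rewrite addr_ge0 ?powR_ge0// sumr_ge0// => k _; rewrite mulr_ge0 ?powR_ge0.
Qed.

(** The finiteness of E|Z|^beta in disguise.  Integrating the dyadic bound, with
    P(|Z| > 2^k x0) = O(2^(- b k)) for some b in (beta, alpha), gives a
    geometric series of ratio 2^(beta - b).  Cutting it at level K keeps all
    integrands bounded; the remaining event, where |th Z| /\ 2 is at most 2,
    costs O(2^(- b K)). *)
Lemma trunc_moment_le (beta : R) : 0 < beta <= 1 -> beta < alpha ->
  exists C : R, 0 <= C /\
    forall th, \int[P]_w Num.min `|th * Z w| 2 <= C * `|th| `^ beta.
Proof.
move=> beta01 ba; have /andP[beta0 beta1] := beta01.
pose b := (beta + alpha) / 2.
have bb : beta < b < alpha by rewrite /b; lra.
have [C [x0 [C0 x00 HC]]] : exists C x0 : R, [/\ 0 <= C, 0 < x0 &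
    forall x, x0 <= x -> tail x <= C * x `^ (- b)] by apply: tail_upper; lra.
pose rho : R := 2 `^ (beta - b).
have rho01 : 0 < rho < 1.
  rewrite powR_gt0//= /rho /powR ifF ?gt_eqF// expR_lt1 nmulr_rlt0 ?ln_gt0 ?ltr1n//.
  by lra.
pose D := 2 `^ beta * x0 `^ beta * (C * x0 `^ (- b)).
have D0 : 0 <= D by rewrite !mulr_ge0 ?powR_ge0.
exists (2 * (x0 `^ beta + D / (1 - rho))); split.
  by rewrite mulr_ge0// addr_ge0 ?powR_ge0// divr_ge0//; lra.
move=> th.
pose A (k : nat) := [set w | 2 ^+ k * x0 < `|Z w|].
have mA k : measurable (A k) by exact: measurable_tail_event.
have tA k : fine (P (A k)) <= C * x0 `^ (- b) * (2 `^ (- b)) ^+ k.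
  apply: le_trans (HC _ _) _.
    by rewrite ler_peMl ?(ltW x00)// exprn_ege1// ler1n.
  by rewrite (powRM _ (exprn_ge0 _ (ler0n R 2)) (ltW x00)) powRXn// mulrAC mulrA.
have key K : \int[P]_w Num.min `|th * Z w| 2 <=
    2 * (x0 `^ beta + D / (1 - rho)) * `|th| `^ beta +
    2 * (C * x0 `^ (- b)) * (2 `^ (- b)) ^+ K.
  pose F w : R := 2 * `|th| `^ beta * (x0 `^ beta +
     \sum_(k < K) (2 ^+ k.+1 * x0) `^ beta * \1_(A k) w) + 2 * \1_(A K) w.
  have bA k : bounded_mfun (\1_(A k) : T -> R) by exact: bounded_mfun_indic.
  have bcA (c : R) k : bounded_mfun (fun w => c * \1_(A k) w).
    by apply: bounded_mfunM => //; exact: bounded_mfun_cst.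
  have bS : bounded_mfun (fun w => \sum_(k < K) (2 ^+ k.+1 * x0) `^ beta * \1_(A k) w).
    by apply: bounded_mfun_sum => k; exact: bcA.
  have bS' : bounded_mfun (fun w => x0 `^ beta +
      \sum_(k < K) (2 ^+ k.+1 * x0) `^ beta * \1_(A k) w).
    by apply: bounded_mfunD => //; exact: bounded_mfun_cst.
  have bS'' : bounded_mfun (fun w => 2 * `|th| `^ beta * (x0 `^ beta +
      \sum_(k < K) (2 ^+ k.+1 * x0) `^ beta * \1_(A k) w)).
    by apply: bounded_mfunM => //; exact: bounded_mfun_cst.
  have indicA k w : (\1_(A k) w : R) = (2 ^+ k * x0 < `|Z w|)%R%:R.
    rewrite indicE; congr (_%:R : R); congr nat_of_bool.
    by apply/idP/idP; rewrite inE.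
  apply: (@le_trans _ _ (\int[P]_w F w)).
    apply: le_Rint.
    - by apply: bounded_mfun_min; apply: measurable_funM => //; exact: measurable_funPT.
    - by apply: bounded_mfunD.
    move=> w; rewrite /F; have [zK|zK] := leP `|Z w| (2 ^+ K * x0).
      apply: (@le_trans _ _ (2 * `|th| `^ beta * (x0 `^ beta +
        \sum_(k < K) (2 ^+ k.+1 * x0) `^ beta * \1_(A k) w))); last first.
        by rewrite lerDl mulr_ge0// indicA.
      apply: le_trans (min2_le_powR _ beta01) _ => //.
      rewrite normrM powRM// mulrA ler_wpM2l ?mulr_ge0 ?powR_ge0//.
      apply: le_trans (powR_le_dyadic _ x00 beta0 zK) _ => //.
      by rewrite lerD2l; apply: ler_sum => k _; rewrite indicA.
    rewrite [X in _ + 2 * X]indicA zK mulr1 -[leLHS]add0r; apply: lerD; last first.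
      by rewrite ge_min lexx orbT.
    rewrite !mulr_ge0 ?powR_ge0// addr_ge0 ?powR_ge0// sumr_ge0// => k _.
    by rewrite mulr_ge0 ?powR_ge0// indicA.
  rewrite /F RintD// RintZ// RintD//; last exact: bounded_mfun_cst.
  rewrite Rint_cst Rint_sum// RintZ// Rint_indic//.
  apply: lerD; last by rewrite -[leRHS]mulrA ler_pM2l.
  rewrite mulrAC ler_wpM2r ?powR_ge0// ler_pM2l// lerD2l.
  under eq_bigr do rewrite RintZ// Rint_indic//.
  apply: (@le_trans _ _ (\sum_(k < K) D * rho ^+ k)).
    apply: ler_sum => k _.
    apply: (@le_trans _ _ ((2 ^+ k.+1 * x0) `^ beta *
       (C * x0 `^ (- b) * (2 `^ (- b)) ^+ k))).
      by rewrite ler_wpM2l ?powR_ge0.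
    rewrite (powRM _ (exprn_ge0 _ (ler0n R 2)) (ltW x00)) powRXn// /D /rho powRD ?exprMn ?exprS.
      by rewrite le_eqVlt; apply/orP; left; apply/eqP; ring.
    by rewrite pnatr_eq0 implybT.
  rewrite -mulr_sumr ler_wpM2l//.
  have r1 : 0 < 1 - rho by lra.
  rewrite -(ler_pM2r r1) mulVf ?gt_eqF//.
  have := subrX1 rho K; have : 0 <= rho ^+ K by rewrite exprn_ge0//; lra.
  by move: (\sum_(i < K) rho ^+ i) => S; lra.
apply/ler_addgt0Pr => e e0.
have b2 : 0 < (2 `^ (- b) : R) < 1.
  rewrite powR_gt0//= /powR ifF ?gt_eqF// expR_lt1 nmulr_rlt0 ?ln_gt0 ?ltr1n//.
  by lra.
pose E := 2 * (C * x0 `^ (- b)).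
have : (E * (2 `^ (- b)) ^+ K) @[K --> \oo] --> (0 : R).
  apply: (cvg_limE (x := E * 0)); last by rewrite mulr0.
  by apply: cvgMr; apply: cvg_expr; rewrite ger0_norm; lra.
move=> /cvgr0Pnorm_le /(_ e e0) [K _ /(_ K (leqnn K)) HK].
apply: le_trans (key K) _; rewrite lerD2l.
exact: le_trans (ler_norm _) HK.
Qed.

Lemma powRN_cvg0 (s : R) : 0 < s -> x `^ (- s) @[x --> +oo] --> (0 : R).
Proof.
move=> s0; apply/cvgr0Pnorm_le => /= e e0.
near=> x.
have x0 : 0 < x by near: x; apply: nbhs_pinfty_gt; exact: num_real.
have ex : e^-1 `^ s^-1 <= x.
  by near: x; apply: nbhs_pinfty_ge; exact: num_real.
rewrite ger0_norm ?powR_ge0// powRN -[leRHS]invrK lef_pV2 ?posrE ?powR_gt0 ?invr_gt0//.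
have <- : (e^-1 `^ s^-1) `^ s = e^-1.
  by rewrite -powRrM mulVf ?gt_eqF// powRr1// invr_ge0 ltW.
by rewrite ge0_ler_powR ?nnegrE ?powR_ge0 ?(ltW s0) ?(ltW x0).
Unshelve. all: by end_near. Qed.

Variable a : nat -> R.
Hypothesis a_gt0 : forall n, (0 < n)%N -> 0 < a n.
Hypothesis a_norm : n%:R * tail (a n) @[n --> \oo] --> (1 : R).

(** The tail never vanishes, so n tail(a_n) could not stay bounded along a
    bounded subsequence of a_n. *)
Lemma norming_infty : a n @[n --> \oo] --> +oo.
Proof.
apply/cvgryPge => A0; pose A := Num.max A0 1.
have A_gt0 : 0 < A by rewrite lt_max ltr01 orbT.
near=> n.
apply: (@le_trans _ _ A); first by rewrite le_max lexx.
rewrite leNgt; apply/negP => aA.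
have h : n%:R * tail (a n) <= 2.
  by near: n; apply: (cvgr_le _ a_norm); rewrite ltr1n.
have h2 : 2 / tail A < n%:R.
  by near: n; exact: nbhs_infty_gtr.
move: h2; rewrite ltr_pdivrMr ?tail_gt0// ltNge => /negP; apply.
by apply: le_trans h; rewrite ler_wpM2l// tail_le// ltW.
Unshelve. all: by end_near. Qed.

Lemma norming_powR_cvg0 s : 0 < s -> (a n) `^ (- s) @[n --> \oo] --> (0 : R).
Proof. by move=> s0; have /cvg_pinftyP := powRN_cvg0 s0; apply; exact: norming_infty. Qed.

(** 1 / n is at most 2 tail(a_n), hence O(a_n^(-b)) for b in (beta, alpha). *)
Lemma norming_upper (beta : R) : 0 < beta < alpha ->
  (a n) `^ beta / n%:R @[n --> \oo] --> (0 : R).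
Proof.
move=> bA; pose b := (beta + alpha) / 2.
have bb : beta < b < alpha by rewrite /b; lra.
have [C [x0 [C0 x00 HC]]] : exists C x0 : R, [/\ 0 <= C, 0 < x0 &
    forall x, x0 <= x -> tail x <= C * x `^ (- b)] by apply: tail_upper; lra.
apply: (@squeeze_cvgr _ _ _ _ (fun=> 0) (fun n => 2 * C * (a n) `^ (- (b - beta)))).
- near=> n; have n0 : (0 < n)%N by near: n; exact: nbhs_infty_gt.
  have an := a_gt0 n0.
  rewrite divr_ge0 ?powR_ge0//=.
  have h : 2^-1 <= n%:R * tail (a n).
    by near: n; apply: (cvgr_ge _ a_norm); lra.
  have ax : x0 <= a n by near: n; exact: (cvgry_ge norming_infty).
  have := HC _ ax; rewrite opprB addrC powRD; last by rewrite (gt_eqF an) implybT.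
  move=> h2; rewrite ler_pdivrMr ?ltr0n//.
  have ab := powR_ge0 (a n) beta.
  have : n%:R * tail (a n) <= n%:R * (C * a n `^ (- b)) by rewrite ler_wpM2l.
  set u := a n `^ beta in ab *; set v := a n `^ (- b); set N : R := n%:R => h3.
  have : 1 * u <= (2 * (N * (C * v))) * u by rewrite ler_wpM2r//; lra.
  rewrite mul1r => h4; apply: le_trans h4 _.
  by rewrite le_eqVlt; apply/orP; left; apply/eqP; ring.
- exact: cvg_cst.
- apply: (cvg_limE (x := 2 * C * 0)); last by rewrite mulr0.
  by apply: cvgMr; apply: norming_powR_cvg0; lra.
Unshelve. all: by end_near. Qed.

(** n is at most 2 / tail(a_n), hence O(a_n^b) for b in (alpha, l). *)
Lemma norming_lower (l : R) : alpha < l ->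
  n%:R / (a n) `^ l @[n --> \oo] --> (0 : R).
Proof.
move=> al; pose b := (l + alpha) / 2.
have bb : alpha < b < l by rewrite /b; lra.
have [c [x0 [c0 x00 Hc]]] : exists c x0 : R, [/\ 0 < c, 0 < x0 &
    forall x, x0 <= x -> c * x `^ (- b) <= tail x] by apply: tail_lower; lra.
apply: (@squeeze_cvgr _ _ _ _ (fun=> 0) (fun n => 2 / c * (a n) `^ (- (l - b)))).
- near=> n; have n0 : (0 < n)%N by near: n; exact: nbhs_infty_gt.
  have an := a_gt0 n0.
  rewrite divr_ge0 ?powR_ge0//=.
  have h : n%:R * tail (a n) <= 2.
    by near: n; apply: (cvgr_le _ a_norm); rewrite ltr1n.
  have ax : x0 <= a n by near: n; exact: (cvgry_ge norming_infty).
  have := Hc _ ax; rewrite opprB powRD; last by rewrite (gt_eqF an) implybT.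
  rewrite powRN => h2; rewrite powRN mulrA ler_wpM2r ?invr_ge0 ?powR_ge0//.
  have ab : 0 < a n `^ b by rewrite powR_gt0.
  rewrite -ler_pdivrMr// ler_pdivlMr//.
  by apply: le_trans h; rewrite -mulrA ler_wpM2l// mulrC.
- exact: cvg_cst.
- apply: (cvg_limE (x := 2 / c * 0)); last by rewrite mulr0.
  by apply: cvgMr; apply: norming_powR_cvg0; lra.
Unshelve. all: by end_near. Qed.

End tail.

(** * A criterion for property (M) *)

Section core.
Context (R : realType) (d d' : measure_display)
  (T : measurableType d) (T' : measurableType d')
  (P : probability T R) (P' : probability T' R)
  (Y : nat -> {RV P >-> R}) (X : int -> {RV P' >-> R}).
Hypothesis YX : two_sided_extension Y X.
Hypothesis Ystat : strongly_stationary Y.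

Variables (beta C : R) (a : nat -> R) (m r : nat -> nat).
Hypothesis momentY : forall th, trunc_moment Y th <= C * `|th| `^ beta.
Hypothesis a_gt0 : forall n, (0 < n)%N -> 0 < a n.
Hypothesis m_infty : m n @[n --> \oo] --> \oo.
Hypothesis m_small : (m n)%:R / n%:R @[n --> \oo] --> (0 : R).
Hypothesis rm : \forall n \near \oo, (r n <= m n)%N.
Hypothesis gaps : n%:R * (r n)%:R / (m n)%:R * (a n `^ beta)^-1
  @[n --> \oo] --> (0 : R).
Hypothesis remainder : (m n)%:R * (a n `^ beta)^-1 @[n --> \oo] --> (0 : R).
Hypothesis mix : n%:R * mixing_coef X (r n) @[n --> \oo] --> (0 : R).

(** There are at most n t / m_n full blocks, each costing r_n truncated moments
    of size O(a_n^(-beta)) and one mixing coefficient, and k remainders of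
    length at most m_n. *)
Lemma property_M_of_gaps : property_M Y a m.
Proof.
split=> //; first exact: cvgny_divn m_infty m_small.
move=> k theta t k0 pt fl.
pose th i := theta`_i; pose tt i := t`_i.
have t_ge0 i : 0 <= tt i.
  have [ik|ki] := ltnP i k; last by rewrite /tt nth_default// size_tuple.
  have := pt; rewrite lt_path_sortedE => /andP[/allP H _].
  by apply/ltW/H/mem_nth; rewrite size_tuple.
have t_mono i : (i.+1 < k)%N -> tt i <= tt i.+1.
  move=> ik; have := pathP 0 pt; move=> /(_ i.+1); rewrite size_tuple => /(_ ik).
  by move=> /ltW.
(* [B i n] bounds the error of the segment between t_i and t_(i+1). *)
pose B i n := tt i * (4 * (C * `|th i| `^ beta) *
    (n%:R * (r n)%:R / (m n)%:R * (a n `^ beta)^-1) +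
    16 * (n%:R * mixing_coef X (r n))) +
  2 * (C * `|th i| `^ beta) * ((m n)%:R * (a n `^ beta)^-1).
have B0 i : B i n @[n --> \oo] --> (0 : R).
  apply: (cvg_limE (x := tt i * (4 * (C * `|th i| `^ beta) * 0 + 16 * 0) +
     2 * (C * `|th i| `^ beta) * 0)); last by ring.
  apply: cvgD; last exact: cvgMr.
  by apply: cvgMr; apply: cvgD; exact: cvgMr.
apply: (@squeeze_cvgr _ _ _ _ (fun=> 0) (fun n => \sum_(i < k) B i n)); last first.
- by apply: cvg0_sum => i; exact: B0.
- exact: cvg_cst.
near=> n; rewrite normc_ge0 /=.
have n0 : (0 < n)%N by near: n; exact: nbhs_infty_gt.
have m0 : (0 < m n)%N by near: n; exact: ((iffLR (cvgnyPge _) m_infty 1%N)).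
have rmn : (r n <= m n)%N by near: n; exact: rm.
pose js i := nth 0%N (0%N :: map_tuple (fl n) t) i.
have jsS i : (i < k)%N -> js i.+1 = fl n (tt i).
  by move=> ik; rewrite /js /= (nth_map 0) ?size_tuple.
have js_mono i : (i < k)%N -> (js i <= js i.+1)%N.
  case: i => [//|i] ik; rewrite !jsS//; last exact: ltnW.
  by apply: le_truncn; rewrite ler_wpM2l ?ler0n// t_mono.
have -> : \prod_(l < k) phi Y a n [tuple m n] [tuple tnth theta l] ^+
    ((fl n (tnth t l) - fl n (nth 0 (0 :: tval t) l)) %/ m n) =
    \prod_(l < k) charfun P (fun w => ((a n)^-1 * th l) * segment Y 0 (m n) w)
      ^+ ((js l.+1 - js l) %/ m n).
  apply: eq_bigr => l _; congr (_ ^+ _).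
    rewrite phiE ?andbT//; congr charfun; apply/funext => w.
    by rewrite big_ord1 /= (tnth_nth 0).
  rewrite jsS// (tnth_nth 0); congr ((_ - _) %/ _)%N.
  case: l => -[|l] lk /=; first by rewrite /js /fl mulr0 truncn0.
  by rewrite jsS// ltnW.
rewrite phiE; last first.
  apply/(pathP 0%N) => i; rewrite size_tuple => ik.
  exact: js_mono.
apply: le_trans (joint_charfun_blocks YX Ystat (js := js)
  (fun i => (a n)^-1 * th i) _ js_mono rmn m0) _ => //.
apply: ler_sum => i _; rewrite /B.
have an : 0 < a n by exact: a_gt0.
have tm : trunc_moment Y ((a n)^-1 * th i) <= C * `|th i| `^ beta * (a n `^ beta)^-1.
  apply: le_trans (momentY _) _.
  by rewrite normrM powRM// normfV (gtr0_norm an) powRV// -mulrA [X in C * X]mulrC.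
have tm0 := trunc_moment_ge0 Y ((a n)^-1 * th i).
set e := trunc_moment _ _ in tm tm0 *; set D := C * `|th i| `^ beta * _ in tm.
have kb : (((js i.+1 - js i) %/ m n)%N)%:R <= tt i * n%:R / (m n)%:R :> R.
  apply: (@le_trans _ _ ((js i.+1)%:R / (m n)%:R)).
    rewrite ler_pdivlMr ?ltr0n// -natrM ler_nat.
    exact: leq_trans (leq_divM _ _) (leq_subr _ _).
  rewrite ler_pM2r ?invr_gt0 ?ltr0n// jsS// /fl mulrC.
  by rewrite truncn_le mulr_ge0.
have al0 := mixing_coef_ge0 X (r n).
have m1 : (m n)%:R^-1 <= 1 :> R by rewrite invf_le1 ?ltr0n// ler1n.
apply: lerD.
  apply: (@le_trans _ _ (tt i * n%:R / (m n)%:R *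
     (4 * (r n)%:R * D + 16 * mixing_coef X (r n)))).
    apply: ler_pM => //; last first.
      by rewrite lerD2r ler_wpM2l// mulr_ge0.
    by rewrite addr_ge0 ?mulr_ge0.
  rewrite -!mulrA ler_wpM2l//.
  rewrite [leLHS](_ : _ = 4 * (C * `|th i| `^ beta) *
    (n%:R * (r n)%:R / (m n)%:R * (a n `^ beta)^-1) +
    (m n)%:R^-1 * (16 * (n%:R * mixing_coef X (r n)))); last by rewrite /D; ring.
  rewrite lerD//; first by rewrite !mulrA.
  by rewrite ler_piMl// !mulr_ge0.
rewrite -[leRHS](_ : 2 * (m n)%:R * D = _); last by rewrite /D; ring.
by rewrite ler_wpM2l// mulr_ge0.
Unshelve. all: by end_near. Qed.

End core.

(** * Choice of the blocks *)

Section rates.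
Context (R : realType).
Implicit Types (u v : nat -> R) (g : R).

Lemma powR_cvg0 u g : 0 < g -> (\forall n \near \oo, 0 <= u n) ->
  u n @[n --> \oo] --> (0 : R) -> (u n) `^ g @[n --> \oo] --> (0 : R).
Proof.
move=> g0 u0 /cvgr0Pnorm_le ucv; apply/cvgr0Pnorm_le => /= e e0.
near=> n.
have un0 : 0 <= u n by near: n.
have : `|u n| <= e `^ g^-1 by near: n; apply: ucv; rewrite powR_gt0.
rewrite !ger0_norm ?powR_ge0// => h.
rewrite -[leRHS](powRr1 (ltW e0)) -(mulVf (lt0r_neq0 g0)) powRrM.
by rewrite ge0_ler_powR ?nnegrE ?powR_ge0 ?(ltW g0).
Unshelve. all: by end_near. Qed.

Lemma powRn_cvg0 g : 0 < g -> n%:R `^ (- g) @[n --> \oo] --> (0 : R).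
Proof.
move=> g0; have /cvg_pinftyP := powRN_cvg0 g0; apply; exact: cvgr_idn.
Qed.

Lemma powRn_cvgy g : 0 < g -> n%:R `^ g @[n --> \oo] --> (+oo : set_system R).
Proof.
move=> g0.
apply/(gtr0_cvgV0 (f := fun n : nat => n%:R `^ g : R)).
  near=> n; rewrite powR_gt0// ltr0n.
  by near: n; exact: nbhs_infty_gt.
apply: cvg_trans (powRn_cvg0 g0); apply: near_eq_cvg.
by near=> n; rewrite powRN.
Unshelve. all: by end_near. Qed.

Lemma truncn_cvgny u : u n @[n --> \oo] --> +oo ->
  Num.truncn (u n) @[n --> \oo] --> \oo.
Proof.
move=> /cvgryPge uoo; apply/cvgnyPge => A; near=> n.
have h : A%:R <= u n by near: n; exact: uoo.
by rewrite truncn_ge_nat// (le_trans _ h).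
Unshelve. all: by end_near. Qed.

Lemma truncn_half (x : R) : 1 <= x -> x <= 2 * (Num.truncn x)%:R.
Proof.
move=> x1; have := truncnS_gt x; rewrite -natr1 => h.
have : 1 <= (Num.truncn x)%:R :> R by rewrite ler1n truncn_gt0.
lra.
Qed.

Lemma truncn_ler (x : R) : 0 <= x -> (Num.truncn x)%:R <= x.
Proof. by move=> x0; rewrite truncn_le. Qed.

Lemma powRnB (n : nat) (b c : R) : (0 < n)%N ->
  n%:R `^ (b - c) = n%:R `^ b / n%:R `^ c :> R.
Proof. by move=> n0; rewrite powRB// pnatr_eq0 -lt0n n0 implybT. Qed.

Lemma geometric_rate_le (rate : nat -> R) : geometric_rate rate ->
  exists q C : R, [/\ 0 < q, q < 1, 0 <= C &
    forall h, (0 < h)%N -> rate h <= C * q ^+ h].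
Proof.
move=> [q [q0 q1 Sy]]; set S := ereal_sup _ in Sy.
have HS h : (0 < h)%N -> ((q ^- h * rate h)%:E <= S)%E.
  by move=> h0; apply: ereal_sup_ubound; exists h.
have SNy : (-oo < S)%E by apply: lt_le_trans (HS 1%N isT); exact: ltNyr.
have Sfin : S \is a fin_num by rewrite fin_real// SNy Sy.
exists q, (Num.max 0 (fine S)); split => //; first by rewrite le_max lexx.
move=> h h0; have := HS h h0; rewrite -[S]fineK// lee_fin.
rewrite ler_pdivrMl ?exprn_gt0// mulrC => H; apply: le_trans H _.
by rewrite ler_wpM2r ?exprn_ge0 ?(ltW q0)// le_max lexx orbT.
Qed.

(** Write q = exp(-c).  As exp(c h) >= (c h)^(k+1) / (k+1)!, the rate at
    h = floor(n^g) is O(n^(- (k+1) g)), and k is chosen with (k+1) g > 1. *)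
Lemma geometric_rate_powR (rate : nat -> R) g :
  (forall h, 0 <= rate h) -> geometric_rate rate -> 0 < g ->
  n%:R * rate (Num.truncn (n%:R `^ g)) @[n --> \oo] --> (0 : R).
Proof.
move=> rate0 /geometric_rate_le[q [C [q0 q1 C0 HC]]] g0.
pose c := - ln q; have c0 : 0 < c by rewrite oppr_gt0 ln_lt0// q0.
pose k := Num.truncn g^-1.
have kg : 1 < k.+1%:R * g by rewrite -ltr_pdivrMr// div1r truncnS_gt.
pose K := C * (k.+1`!%:R * (2 / c) ^+ k.+1).
apply: (@squeeze_cvgr _ _ _ _ (fun=> 0)
  (fun n => K * n%:R `^ (- (k.+1%:R * g - 1)))).
- near=> n; rewrite mulr_ge0//=.
  have n0 : (0 < n)%N by near: n; exact: nbhs_infty_gt.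
  have n0' : 0 < n%:R :> R by rewrite ltr0n.
  have ng : 1 <= n%:R `^ g :> R.
    by near: n; have /cvgryPge := powRn_cvgy g0; apply.
  set h := Num.truncn _; have h0 : (0 < h)%N by rewrite truncn_gt0.
  have hh := truncn_half ng; rewrite -/h in hh.
  have hR : 0 < h%:R :> R by rewrite ltr0n.
  have qh : q ^+ h <= k.+1`!%:R / (c * h%:R) ^+ k.+1.
    have := @expR_ge1Dxn R (c * h%:R) k (mulr_ge0 (ltW c0) (ltW hR)).
    have -> : expR (c * h%:R) = (q ^+ h)^-1.
      by rewrite /c mulNr expRN expRM_natr lnK.
    move=> H; have : (c * h%:R) ^+ k.+1 / k.+1`!%:R <= (q ^+ h)^-1.
      by apply: le_trans H; rewrite lerDr.
    have f0 : 0 < k.+1`!%:R :> R by rewrite ltr0n fact_gt0.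
    have ch : 0 < (c * h%:R) ^+ k.+1 by rewrite exprn_gt0// mulr_gt0.
    have qh0 : 0 < q ^+ h by rewrite exprn_gt0.
    have qh1 : 0 < k.+1`!%:R / (c * h%:R) ^+ k.+1 by rewrite divr_gt0.
    by rewrite -(lef_pV2 qh1 qh0) invf_div.
  apply: (@le_trans _ _ (n%:R * (C * (k.+1`!%:R / (c * h%:R) ^+ k.+1)))).
    by rewrite ler_wpM2l// (le_trans (HC _ h0))// ler_wpM2l.
  have ng0 : 0 < n%:R `^ g :> R by rewrite powR_gt0.
  rewrite opprB powRnB// powRr1// [k.+1%:R * g]mulrC powRrM powR_mulrn ?powR_ge0//.
  have le1 : (c * h%:R)^-1 <= 2 / c / n%:R `^ g.
    rewrite invfM -[2 / c]mulrC -mulrA ler_pM2l ?invr_gt0//.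
    by rewrite ler_pdivlMr// mulrC ler_pdivrMr.
  have leK : ((c * h%:R) ^+ k.+1)^-1 <= (2 / c) ^+ k.+1 / (n%:R `^ g) ^+ k.+1.
    rewrite -exprVn -expr_div_n lerXn2r ?nnegrE//.
      by rewrite invr_ge0 mulr_ge0// ltW.
    by rewrite !divr_ge0 ?powR_ge0// ltW.
  rewrite /K [leRHS](_ : _ = n%:R * (C * (k.+1`!%:R *
    ((2 / c) ^+ k.+1 / (n%:R `^ g) ^+ k.+1)))); last by ring.
  by rewrite !ler_wpM2l.
- exact: cvg_cst.
- apply: (cvg_limE (x := K * 0)); last by rewrite mulr0.
  by apply: cvgMr; apply: powRn_cvg0; lra.
Unshelve. all: by end_near. Qed.

End rates.

Section conclusions.
Context (R : realType) (d d' : measure_display)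
  (T : measurableType d) (T' : measurableType d')
  (P : probability T R) (P' : probability T' R)
  (Y : nat -> {RV P >-> R}) (X : int -> {RV P' >-> R})
  (alpha : R) (a : nat -> R).
Hypothesis YX : two_sided_extension Y X.
Hypothesis Ystat : strongly_stationary Y.
Hypothesis alpha_bounds : 0 < alpha < 2.
Hypothesis Yrv : regularly_varying (Y 1%N) alpha.
Hypothesis a_gt0 : forall n, (0 < n)%N -> 0 < a n.
Hypothesis a_norm :
  n%:R * fine (P [set w | a n < `|Y 1%N w|]) @[n --> \oo] --> (1 : R).
Let rate h := mixing_coef X h.

(** With y_n = eps_n a_n^(2 beta) / n and x_n = sqrt(eps_n) a_n^beta one has
    x_n^2 = n y_n.  Taking r_n ~ y_n and m_n ~ x_n gives r_n / m_n ~ x_n / n,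
    which tends to 0 because beta < alpha, and n r_n / (m_n a_n^beta) and
    m_n / a_n^beta both of order sqrt(eps_n). *)
Lemma property_M_of_mixing_gap (eps : nat -> R) (beta : R) :
    alpha / 2 < beta < Num.min alpha 1 ->
    (forall n, (0 < n)%N -> 0 <= eps n) ->
    eps n @[n --> \oo] --> (0 : R) ->
    eps n * a n `^ (2 * beta) / n%:R @[n --> \oo] --> +oo ->
    n%:R * rate (Num.truncn (eps n * a n `^ (2 * beta) / n%:R)).+1
      @[n --> \oo] --> (0 : R) ->
  exists m : nat -> nat,
     [/\ forall n, (0 < n)%N -> (0 < m n)%N,
         property_M Y a m
       & exists r : nat -> nat,
         [/\ forall n, (0 < n)%N -> (0 < r n)%N,
             r n @[n --> \oo] --> \oo,
             (r n)%:R / (m n)%:R @[n --> \oo] --> (0 : R)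
           & n%:R * rate (r n) @[n --> \oo] --> (0 : R)]].
Proof.
rewrite lt_min => /and3P[ab ba b1] eps0 epscv ycv ratecv.
have b0 : 0 < beta by lra.
pose y n := eps n * a n `^ (2 * beta) / n%:R.
pose s n := Num.sqrt (eps n).
pose A n := a n `^ beta.
pose x n := s n * A n.
have scv : s n @[n --> \oo] --> (0 : R).
  apply: (cvg_limE (x := Num.sqrt 0)); last by rewrite sqrtr0.
  by apply: (cvg_comp _ _ epscv); exact: sqrt_continuous.
have Acv : A n / n%:R @[n --> \oo] --> (0 : R).
  by apply: (norming_upper Yrv a_gt0 a_norm); lra.
have xncv : x n / n%:R @[n --> \oo] --> (0 : R).
  apply: (cvg_limE (x := 0 * 0)); last by rewrite mulr0.
  by under eq_fun do rewrite /x -mulrA; exact: cvgM.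
have A0 n : (0 < n)%N -> 0 < A n by move=> n0; rewrite powR_gt0 ?a_gt0.
have xy n : (0 < n)%N -> x n ^+ 2 = n%:R * y n.
  move=> n0; have -> : x n ^+ 2 = eps n * a n `^ (2 * beta).
    rewrite /x exprMn sqr_sqrtr ?eps0// [2 * beta]mulrC powRrM.
    by rewrite powR_mulrn ?powR_ge0.
  by rewrite /y; field; rewrite pnatr_eq0 -lt0n.
have x0 n : 0 <= x n by rewrite mulr_ge0 ?sqrtr_ge0 ?powR_ge0.
have y1 : \forall n \near \oo, 1 <= y n by exact: (cvgry_ge ycv).
have x_ge_y : \forall n \near \oo, y n <= x n.
  near=> n.
  have n0 : (0 < n)%N by near: n; exact: nbhs_infty_gt.
  have n0' : 0 < n%:R :> R by rewrite ltr0n.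
  have yn : 1 <= y n by near: n.
  have : `|x n / n%:R| <= 1 by near: n; move/cvgr0Pnorm_le : xncv; apply.
  rewrite ger0_norm ?divr_ge0// ler_pdivrMr// mul1r => xn.
  have := xy n n0; have := x0 n; rewrite expr2; nra.
have xcv : x n @[n --> \oo] --> +oo by apply: ger_cvgy ycv.
(* The successors keep both lengths positive for every n. *)
pose r n := (Num.truncn (y n)).+1.
pose m n := (Num.truncn (x n)).+1.
have mx n : x n <= (m n)%:R <= x n + 1.
  by rewrite ltW ?truncnS_gt//= /m -natr1 lerD2r truncn_ler.
have ry n : 0 <= y n -> (r n)%:R <= y n + 1.
  by move=> y0; rewrite /r -natr1 lerD2r truncn_ler.
have xinv : (x n)^-1 @[n --> \oo] --> (0 : R).
  apply/gtr0_cvgV0 => //; near=> n.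
  by apply: (@lt_le_trans _ _ 1) => //; near: n; exact: (cvgry_ge xcv).
have rmcv : (r n)%:R / (m n)%:R @[n --> \oo] --> (0 : R).
  apply: (@squeeze_cvgr _ _ _ _ (fun=> 0) (fun n => x n / n%:R + (x n)^-1)).
  - near=> n; rewrite divr_ge0//=.
    have n0 : (0 < n)%N by near: n; exact: nbhs_infty_gt.
    have n0' : 0 < n%:R :> R by rewrite ltr0n.
    have yn : 1 <= y n by near: n.
    have xn : y n <= x n by near: n.
    have xn0 : 0 < x n by lra.
    have -> : x n / n%:R + (x n)^-1 = (y n + 1) / x n.
      rewrite mulrDl mul1r; congr (_ + _).
      apply: (mulIf (lt0r_neq0 xn0)); rewrite mulfVK ?gt_eqF//.
      rewrite mulrAC -expr2 xy//; field; exact: lt0r_neq0.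
    apply: ler_pM => //; first by apply: ry; lra.
    by rewrite lef_pV2 ?posrE ?ltr0n//; case/andP: (mx n).
  - exact: cvg_cst.
  - apply: (cvg_limE (x := 0 + 0)); last by rewrite addr0.
    exact: cvgD.
exists m; split=> //; last first.
  exists r; split => //.
  have /cvgnyPge H := truncn_cvgny ycv.
  by apply/cvgnyPge => B; apply: filterS (H B) => n; exact: leqW.
have [C [C0 HC]] : exists C : R, 0 <= C /\
    forall th, trunc_moment Y th <= C * `|th| `^ beta.
  by apply: (trunc_moment_le Yrv) => //; rewrite b0 ltW.
apply: (property_M_of_gaps YX Ystat (r := r) HC) => //.
- have /cvgnyPge H := truncn_cvgny xcv.
  by apply/cvgnyPge => B; apply: filterS (H B) => n; exact: leqW.
- apply: (@squeeze_cvgr _ _ _ _ (fun=> 0) (fun n => 2 * (x n / n%:R))).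
  + near=> n; rewrite divr_ge0//= mulrA ler_wpM2r ?invr_ge0//.
    have : 1 <= x n by near: n; exact: (cvgry_ge xcv).
    by have := mx n; lra.
  + exact: cvg_cst.
  + by apply: (cvg_limE (x := 2 * 0)); [exact: cvgMr|rewrite mulr0].
- near=> n.
  have : `|(r n)%:R / (m n)%:R : R| <= 1.
    by near: n; move/cvgr0Pnorm_le : rmcv; apply.
  by rewrite ger0_norm ?divr_ge0// ler_pdivrMr ?ltr0n// mul1r ler_nat.
- apply: (@squeeze_cvgr _ _ _ _ (fun=> 0) (fun n => 2 * s n)).
  + near=> n.
    have n0 : (0 < n)%N by near: n; exact: nbhs_infty_gt.
    have n0' : 0 < n%:R :> R by rewrite ltr0n.
    have yn : 1 <= y n by near: n.
    have xn : y n <= x n by near: n.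
    have xn0 : 0 < x n by lra.
    have An := A0 n n0.
    rewrite !mulr_ge0 ?invr_ge0//= ?powR_ge0//.
    rewrite -/(A n) ler_pdivrMr// ler_pdivrMr ?ltr0n//.
    apply: (@le_trans _ _ (2 * x n * x n)); last first.
      rewrite -[2 * s n * A n]mulrA -/(x n) ler_wpM2l ?(mulr_ge0 (ler0n R 2) (x0 n))//.
      by case/andP: (mx n).
    rewrite -mulrA -expr2 xy// mulrCA ler_pM2l//.
    by apply: le_trans (ry _ _) _; lra.
  + exact: cvg_cst.
  + by apply: (cvg_limE (x := 2 * 0)); [exact: cvgMr|rewrite mulr0].
- apply: (@squeeze_cvgr _ _ _ _ (fun=> 0) (fun n => 2 * s n)).
  + near=> n.
    have n0 : (0 < n)%N by near: n; exact: nbhs_infty_gt.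
    have An := A0 n n0.
    rewrite mulr_ge0 ?invr_ge0 ?powR_ge0//= -/(A n) ler_pdivrMr//.
    rewrite -mulrA -/(x n).
    have : 1 <= x n by near: n; exact: (cvgry_ge xcv).
    by have := mx n; lra.
  + exact: cvg_cst.
  + by apply: (cvg_limE (x := 2 * 0)); [exact: cvgMr|rewrite mulr0].
Unshelve. all: by end_near. Qed.

(** The sequence delta_n = (n / a_n^(2 beta))^(1/2) tends to 0, because
    2 beta > alpha, while delta_n a_n^(2 beta) / n = 1 / delta_n tends to
    infinity.  Adding it to eps_n makes the gaps long; under M_0-dependence it
    serves alone, with beta halfway between alpha / 2 and alpha /\ 1. *)
Lemma property_M_of_fast_mixing :
  ((exists M0 : nat, M0_dependent rate M0) \/
   (exists (eps : nat -> R) (beta : R),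
     [/\ forall n, (0 < n)%N -> 0 < eps n,
         eps n @[n --> \oo] --> (0 : R),
         alpha / 2 < beta < Num.min alpha 1
       & n%:R * rate (Num.truncn (eps n * a n `^ (2 * beta) / n%:R))
           @[n --> \oo] --> (0 : R)]) ->
   exists m : nat -> nat,
     [/\ forall n, (0 < n)%N -> (0 < m n)%N,
         property_M Y a m
       & exists r : nat -> nat,
         [/\ forall n, (0 < n)%N -> (0 < r n)%N,
             r n @[n --> \oo] --> \oo,
             (r n)%:R / (m n)%:R @[n --> \oo] --> (0 : R)
           & n%:R * rate (r n) @[n --> \oo] --> (0 : R)]]).
Proof.
pose del beta n := (n%:R / a n `^ (2 * beta)) `^ 2^-1.
have del0 beta n : 0 <= del beta n by exact: powR_ge0.
have delcv beta : alpha / 2 < beta -> del beta n @[n --> \oo] --> (0 : R).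
  move=> ab; apply: powR_cvg0; first lra.
    by apply: nearW => n; rewrite divr_ge0 ?powR_ge0.
  by apply: (norming_lower Yrv a_gt0 a_norm); lra.
have dely beta : alpha / 2 < beta ->
    del beta n * a n `^ (2 * beta) / n%:R @[n --> \oo] --> +oo.
  move=> ab; have dgt0 : \forall n \near \oo, 0 < del beta n.
    near=> n; have n0 : (0 < n)%N by near: n; exact: nbhs_infty_gt.
    by rewrite powR_gt0// divr_gt0 ?ltr0n ?powR_gt0 ?a_gt0.
  have /(cvgrVy dgt0) := delcv _ ab.
  apply: cvg_trans; apply: near_eq_cvg; near=> n.
  have n0 : (0 < n)%N by near: n; exact: nbhs_infty_gt.
  have n0' : 0 < n%:R :> R by rewrite ltr0n.
  have an : 0 < a n `^ (2 * beta) by rewrite powR_gt0 ?a_gt0.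
  have dn : 0 < del beta n by near: n.
  have d2 : del beta n ^+ 2 = n%:R / a n `^ (2 * beta).
    rewrite /del -powR_mulrn ?powR_ge0// -powRrM mulVf ?pnatr_eq0// powRr1//.
    by rewrite divr_ge0// ltW.
  apply: (mulIf (lt0r_neq0 dn)); rewrite /= mulVf ?lt0r_neq0//.
  rewrite [RHS](_ : _ = del beta n ^+ 2 * a n `^ (2 * beta) / n%:R); last by ring.
  by rewrite d2; field; rewrite !lt0r_neq0.
case=> [[M0 HM0]|[eps [beta [eps0 epscv bb ratecv]]]].
  pose beta := (alpha / 2 + Num.min alpha 1) / 2.
  have am : alpha / 2 < Num.min alpha 1 by rewrite lt_min; move: alpha_bounds; lra.
  have bb : alpha / 2 < beta < Num.min alpha 1 by rewrite /beta; lra.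
  have ab : alpha / 2 < beta by case/andP: bb.
  apply: (property_M_of_mixing_gap bb (fun n _ => del0 beta n) (delcv _ ab) (dely _ ab)).
  apply: cvg_near_cst; near=> n; rewrite HM0 ?mulr0// ltnS.
  by near: n; have /cvgnyPge := truncn_cvgny (dely _ ab); apply.
have ab : alpha / 2 < beta by case/andP: bb.
apply: (@property_M_of_mixing_gap (fun n => eps n + del beta n) beta bb).
- by move=> n n0; rewrite addr_ge0// ltW// eps0.
- apply: (cvg_limE (x := 0 + 0)); last by rewrite addr0.
  by apply: cvgD => //; exact: delcv.
- apply: ger_cvgy (dely _ ab); near=> n.
  rewrite -!mulrA ler_wpM2r ?mulr_ge0 ?powR_ge0 ?invr_ge0// lerDr ltW// eps0//.
  by near: n; exact: nbhs_infty_gt.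
- apply: (@squeeze_cvgr _ _ _ _ (fun=> 0) _ _ _ _ _ ratecv); last exact: cvg_cst.
  near=> n; rewrite mulr_ge0 ?mixing_coef_ge0//= ler_wpM2l//.
  apply: mixing_coef_le; apply: leqW; apply: le_truncn.
  by rewrite -!mulrA ler_wpM2r ?mulr_ge0 ?powR_ge0 ?invr_ge0// lerDl.
Unshelve. all: by end_near. Qed.

(** (M) is obtained with gaps n^delta, where delta <= gamma_1 and
    1 + delta <= 2 gamma_2; then n n^delta / m_n and m_n are both
    O(n^gamma_2), which is o(a_n^beta) for beta in
    (alpha gamma_2, alpha /\ 1). *)
Lemma property_M_of_geometric_mixing : geometric_rate rate ->
   forall gamma1 gamma2 : R,
     0 < gamma1 < 1 -> 0 < gamma2 < 1 -> gamma1 < gamma2 ->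
     2^-1 < gamma2 < Num.min alpha^-1 1 ->
     let m n := Num.truncn (n%:R `^ gamma2) in
     let r n := Num.truncn (n%:R `^ gamma1) in
     [/\ property_M Y a m,
         r n @[n --> \oo] --> \oo,
         (r n)%:R / (m n)%:R @[n --> \oo] --> (0 : R)
       & n%:R * rate (r n) @[n --> \oo] --> (0 : R)].
Proof.
move=> geo g1 g2 g101 g201 g12 /andP[g2h]; rewrite lt_min => /andP[g2a g21] m r.
have a0 : 0 < alpha by case/andP: alpha_bounds.
have rate0 h : 0 <= rate h by exact: mixing_coef_ge0.
have ncv g : 0 < g -> Num.truncn (n%:R `^ g : R) @[n --> \oo] --> \oo.
  by move=> g0; apply: truncn_cvgny; exact: powRn_cvgy.
have ng g : 0 < g -> \forall n \near \oo, 1 <= n%:R `^ g :> R.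
  by move=> g0; have /cvgryPge := powRn_cvgy g0; apply.
split; [|by apply: ncv; lra| |by apply: geometric_rate_powR => //; lra]; last first.
  apply: (@squeeze_cvgr _ _ _ _ (fun=> 0) (fun n => 2 * n%:R `^ (- (g2 - g1)))).
  - near=> n; rewrite divr_ge0//=.
    have n0 : (0 < n)%N by near: n; exact: nbhs_infty_gt.
    have n1 : 1 <= n%:R `^ g2 :> R by near: n; apply: ng; lra.
    have h1 : n%:R `^ g2 <= 2 * (m n)%:R by exact: truncn_half.
    have h2 : (r n)%:R <= n%:R `^ g1 :> R by rewrite truncn_ler ?powR_ge0.
    have m0 : 0 < (m n)%:R :> R by lra.
    rewrite ler_pdivrMr// opprB powRnB//.
    have h3 := powR_ge0 (n%:R : R) g1.
    rewrite [leRHS](_ : _ = n%:R `^ g1 * ((2 * (m n)%:R) / n%:R `^ g2)); last by ring.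
    apply: le_trans h2 _; rewrite ler_peMr// ler_pdivlMr ?mul1r//; lra.
  - exact: cvg_cst.
  - apply: (cvg_limE (x := 2 * 0)); last by rewrite mulr0.
    by apply: cvgMr; apply: powRn_cvg0; lra.
pose delta := Num.min g1 (2 * g2 - 1).
have d0 : 0 < delta by rewrite lt_min; lra.
have d1 : delta <= g1 by rewrite ge_min lexx.
have d2 : 1 + delta <= 2 * g2.
  have : delta <= 2 * g2 - 1 by rewrite ge_min lexx orbT.
  lra.
have ag : alpha * g2 < Num.min alpha 1.
  by rewrite lt_min gtr_pMr// g21/= mulrC -ltr_pdivlMr// div1r.
pose beta := (alpha * g2 + Num.min alpha 1) / 2.
have bb : alpha * g2 < beta < Num.min alpha 1 by rewrite /beta; lra.
have [bb1 bb2] := andP bb; move: bb2; rewrite lt_min => /andP[ba b1].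
have b0 : 0 < beta by apply: lt_trans bb1; rewrite mulr_gt0//; lra.
have [C [C0 HC]] : exists C : R, 0 <= C /\
    forall th, trunc_moment Y th <= C * `|th| `^ beta.
  by apply: (trunc_moment_le Yrv) => //; rewrite b0 ltW.
have g20 : 0 < g2 by lra.
have bcv : n%:R `^ g2 * (a n `^ beta)^-1 @[n --> \oo] --> (0 : R).
  have al : alpha < beta / g2 by rewrite ltr_pdivlMr.
  have ucv := norming_lower Yrv a_gt0 a_norm al.
  have := powR_cvg0 g20 _ ucv; move=> H.
  apply: cvg_trans (H _); last by apply: nearW => n; rewrite divr_ge0 ?powR_ge0.
  apply: near_eq_cvg; near=> n.
  have n0 : (0 < n)%N by near: n; exact: nbhs_infty_gt.
  rewrite powRM ?invr_ge0 ?powR_ge0// powRV ?powR_gt0 ?a_gt0//.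
  by rewrite -powRrM mulfVK ?gt_eqF.
apply: (property_M_of_gaps YX Ystat
  (r := fun n => Num.truncn (n%:R `^ delta)) HC) => //.
- by apply: ncv.
- apply: (@squeeze_cvgr _ _ _ _ (fun=> 0) (fun n => n%:R `^ (- (1 - g2)))).
  + near=> n; rewrite divr_ge0//=.
    have n0 : (0 < n)%N by near: n; exact: nbhs_infty_gt.
    rewrite opprB powRnB// powRr1// ler_wpM2r ?invr_ge0//.
    by rewrite truncn_ler ?powR_ge0.
  + exact: cvg_cst.
  + by apply: powRn_cvg0; lra.
- near=> n.
  have n0 : (0 < n)%N by near: n; exact: nbhs_infty_gt.
  by apply: le_truncn; apply: ler_powR; [rewrite ler1n|lra].
- apply: (@squeeze_cvgr _ _ _ _ (fun=> 0)
    (fun n => 2 * (n%:R `^ g2 * (a n `^ beta)^-1))).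
  + near=> n; rewrite !mulr_ge0 ?invr_ge0 ?powR_ge0//=.
    have n0 : (0 < n)%N by near: n; exact: nbhs_infty_gt.
    rewrite mulrA ler_wpM2r ?invr_ge0 ?powR_ge0//.
    have n1 : 1 <= n%:R `^ g2 :> R by near: n; exact: ng.
    have h1 : n%:R `^ g2 <= 2 * (m n)%:R by exact: truncn_half.
    have h2 : (Num.truncn (n%:R `^ delta : R))%:R <= n%:R `^ delta :> R.
      by rewrite truncn_ler ?powR_ge0.
    have m0 : 0 < (m n)%:R :> R by lra.
    rewrite ler_pdivrMr//.
    apply: (@le_trans _ _ (n%:R * n%:R `^ delta)); first by rewrite ler_wpM2l.
    apply: (@le_trans _ _ (n%:R `^ g2 * n%:R `^ g2)).
      rewrite -{1}(powRr1 (ler0n R n)) -!powRD ?pnatr_eq0 -?lt0n ?n0 ?implybT//.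
      by rewrite ler_powR ?ler1n//; lra.
    by rewrite -[2 * _ * _]mulrA mulrCA ler_wpM2l ?powR_ge0.
  + exact: cvg_cst.
  + by apply: (cvg_limE (x := 2 * 0)); [exact: cvgMr|rewrite mulr0].
- apply: (@squeeze_cvgr _ _ _ _ (fun=> 0) (fun n => n%:R `^ g2 * (a n `^ beta)^-1)).
  + near=> n; rewrite mulr_ge0 ?invr_ge0 ?powR_ge0//=.
    by rewrite ler_wpM2r ?invr_ge0 ?powR_ge0// truncn_ler ?powR_ge0.
  + exact: cvg_cst.
  + exact: bcv.
- exact: geometric_rate_powR.
Unshelve. all: by end_near. Qed.

End conclusions.

Theorem lemma2p3 (R : realType) (d : measure_display) (T : measurableType d)
  (P : probability T R) (Y : nat -> {RV P >-> R}) (rate : nat -> R)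
  (alpha : R) (a : nat -> R)
  (Ystat : strongly_stationary Y)
  (Ymix : strongly_mixing Y rate)
  (alpha_bounds : 0 < alpha < 2)
  (Yrv : regularly_varying (Y 1%N) alpha)
  (a_gt0 : forall n, (0 < n)%N -> 0 < a n)
  (a_norm : n%:R * fine (P [set w | a n < `|Y 1%N w|]) @[n --> \oo] --> (1 : R)) :
  ((exists M0 : nat, M0_dependent rate M0) \/
   (exists (eps : nat -> R) (beta : R),
     [/\ forall n, (0 < n)%N -> 0 < eps n,
         eps n @[n --> \oo] --> (0 : R),
         alpha / 2 < beta < Num.min alpha 1
       & n%:R * rate (Num.truncn (eps n * a n `^ (2 * beta) / n%:R))
           @[n --> \oo] --> (0 : R)]) ->
   exists m : nat -> nat,
     [/\ forall n, (0 < n)%N -> (0 < m n)%N,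
         property_M Y a m
       & exists r : nat -> nat,
         [/\ forall n, (0 < n)%N -> (0 < r n)%N,
             r n @[n --> \oo] --> \oo,
             (r n)%:R / (m n)%:R @[n --> \oo] --> (0 : R)
           & n%:R * rate (r n) @[n --> \oo] --> (0 : R)]])
  /\
  (geometric_rate rate ->
   forall gamma1 gamma2 : R,
     0 < gamma1 < 1 -> 0 < gamma2 < 1 -> gamma1 < gamma2 ->
     2^-1 < gamma2 < Num.min alpha^-1 1 ->
     let m n := Num.truncn (n%:R `^ gamma2) in
     let r n := Num.truncn (n%:R `^ gamma1) in
     [/\ property_M Y a m,
         r n @[n --> \oo] --> \oo,
         (r n)%:R / (m n)%:R @[n --> \oo] --> (0 : R)
       & n%:R * rate (r n) @[n --> \oo] --> (0 : R)]).
Proof.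
have [[d' [T' [P' [X [YX /funext rateE]]]]] _] := Ymix.
rewrite rateE; split.
  exact: property_M_of_fast_mixing YX Ystat alpha_bounds Yrv a_gt0 a_norm.
exact: property_M_of_geometric_mixing YX Ystat alpha_bounds Yrv a_gt0 a_norm.
Qed.
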